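(* Let $W$ be the Weyl group of type $D_{n+2}$ with simple reflections $0^+,0^-,1,\dots,n$. For $0\leq j\leq n$ and $1\leq k\leq n+1-j$ put $d_k^{0^{\pm}j}:=\phi^{\pm}(b_k^{0j})\in W$. (1) We have finite chains $${}_{0^+}\mathbf{JI}_{0^+}=\{d_1^{0^+0}<d_3^{0^+0}<d_5^{0^+0}<\cdots\},\qquad {}_{0^+}\mathbf{JI}_{0^-}=\{d_2^{0^+0}<d_4^{0^+0}<d_6^{0^+0}<\cdots\},$$ where the indices run over all odd (respectively, even) $k$ with $1\leq k\leq n+1$ (so the last elements are $d_n^{0^+0}$ and $d_{n+1}^{0^+0}$, in the order depending on the parity of $n$). (2) For $1\leq j\leq n$, we have $${}_{0^+}\mathbf{JI}_{j}=\{d_1^{0^+j}<d_2^{0^+j}<\cdots<d_{n+1-j}^{0^+j}\}.$$ (3) The analogous statements, obtained by interchanging $0^+$ with $0^-$ (and $\phi^+$ with $\phi^-$), hold for ${}_{0^-}\mathbf{JI}_{j}$, $j\in\{0^+,0^-,1,\dots,n\}$.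
   Context: Type $D_{n+2}$ (with $n\geq2$): the Coxeter diagram is simply laced with nodes $0^+,0^-,1,\dots,n$; edges $m-(m+1)$ for $1\leq m<n$, and $0^+-1$, $0^--1$. $\leq$ is the Bruhat order on $W$. An element $w\in W$ is join-irreducible if there is no $U\subseteq W$ with $w=\bigvee U$ (supremum in $(W,\leq)$, $\bigvee\varnothing=e$) and $w\notin U$. Every join-irreducible element has exactly one left descent and one right descent; ${}_i\mathbf{JI}_j$ is the set of join-irreducible elements with left descent $i$ and right descent $j$, ordered by the Bruhat order. A set written as $\{a<b<\cdots\}$ means the set of the listed elements, which form a chain as indicated. The elements $b_k^{0j}$ belong to the Weyl group of type $B_{n+1}$ (simple reflections $0,1,\dots,n$ along the path $0-1-\cdots-n$, double edge between $0$ and $1$) and are given by the reduced words $$b_k^{0j}=s_{00}\cdot s_{10}\cdots s_{k-1,0}\cdot s_{k,1}\cdot s_{k+1,2}\cdots s_{k+j-1,j},$$ where $s_{ab}=a\cdots b$ is the word along the shortest path from $a$ to $b$ in $0-1-\cdots-n$. The maps $\phi^{\pm}$ (defined on join-irreducible elements of type $B_{n+1}$) take a reduced word, replace the occurrences of $0$ alternatingly by $0^+$ and $0^-$, where for $\phi^+$ the leftmost occurrence is replaced by $0^+$ and for $\phi^-$ the leftmost occurrence is replaced by $0^-$, keep the other letters, and return the corresponding element of $W$; the result does not depend on the reduced word. E.g. $\phi^+(0102103210)=0^+1\,0^-21\,0^+321\,0^-$. *)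

(* Defs.v *)
From HB Require Import structures.
From Stdlib Require Import Relation_Operators.
From mathcomp Require Import all_boot all_order.
From mathcomp Require Import boolp classical_sets.

Set Implicit Arguments.
Unset Strict Implicit.
Unset Printing Implicit Defensive.

Import Order.TTheory.

Local Open Scope classical_set_scope.
Local Open Scope quotient_scope.
Local Open Scope group_scope.

(* The value 0 off the diagonal stands for an infinite order. *)
Record coxeter_matrix (S : choiceType) := CoxeterMatrix {
  cox_order :> S -> S -> nat;
  cox_order_diag : forall s, cox_order s s = 1%N;
  cox_order_offdiag : forall s t, s != t -> cox_order s t != 1%N;
  cox_order_sym : forall s t, cox_order s t = cox_order t s
}.

Section CoxeterGroup.
Variables (S : choiceType) (m : coxeter_matrix S).

(* The congruence on the free monoid [seq S] generated by the Coxeter relators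
   (st)^m(s,t) = 1. The relators (ss)^1 = 1 make the generators invertible, so
   the quotient monoid is the Coxeter group. *)
Inductive cox_equiv : seq S -> seq S -> Prop :=
| cox_equiv_relator s t u v :
    cox_equiv (u ++ flatten (nseq (m s t) [:: s; t]) ++ v) (u ++ v)
| cox_equiv_refl u : cox_equiv u u
| cox_equiv_sym u v : cox_equiv u v -> cox_equiv v u
| cox_equiv_trans u v w : cox_equiv u v -> cox_equiv v w -> cox_equiv u w.

Definition cox_equivb (u v : seq S) : bool := `[< cox_equiv u v >].

Fact cox_equivb_refl : reflexive cox_equivb.
Proof. by move=> u; apply/asboolP; apply: cox_equiv_refl. Qed.

Fact cox_equivb_sym : symmetric cox_equivb.
Proof. by move=> u v; apply/asboolP/asboolP => /cox_equiv_sym. Qed.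

Fact cox_equivb_trans : transitive cox_equivb.
Proof.
move=> v u w /asboolP uv /asboolP vw; apply/asboolP.
exact: cox_equiv_trans uv vw.
Qed.

Canonical cox_equiv_rel :=
  EquivRel cox_equivb cox_equivb_refl cox_equivb_sym cox_equivb_trans.

Definition coxeter_group := {eq_quot cox_equiv_rel}.
HB.instance Definition _ := EqQuotient.on coxeter_group.
HB.instance Definition _ := Choice.on coxeter_group.

Definition cox_word (u : seq S) : coxeter_group := \pi_coxeter_group u.

Lemma cox_wordP u v : cox_word u = cox_word v <-> cox_equiv u v.
Proof.
rewrite /cox_word; split=> [/eqP|uv]; last by apply/eqmodP/asboolP.
by rewrite eqmodE => /asboolP.
Qed.

Lemma cox_word_surj (w : coxeter_group) : exists u, cox_word u = w.
Proof. by exists (repr w); rewrite /cox_word reprK. Qed.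

Lemma cox_equiv_cat u u' v v' :
  cox_equiv u u' -> cox_equiv v v' -> cox_equiv (u ++ v) (u' ++ v').
Proof.
move=> uu' vv'; apply: (@cox_equiv_trans _ (u' ++ v)).
  elim: uu' => [s t x y|x|x y _|x y z _ xy _ yz].
  - by rewrite -!catA; apply: cox_equiv_relator.
  - exact: cox_equiv_refl.
  - exact: cox_equiv_sym.
  - exact: cox_equiv_trans xy yz.
elim: vv' => [s t x y|x|x y _|x y z _ xy _ yz].
- by rewrite !(catA u'); apply: cox_equiv_relator.
- exact: cox_equiv_refl.
- exact: cox_equiv_sym.
- exact: cox_equiv_trans xy yz.
Qed.

Lemma cox_equiv_square s u v : cox_equiv (u ++ [:: s; s] ++ v) (u ++ v).
Proof. by have := cox_equiv_relator s s u v; rewrite cox_order_diag. Qed.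

Lemma cox_equiv_revl u : cox_equiv (rev u ++ u) [::].
Proof.
elim: u => [|s u IHu]; first exact: cox_equiv_refl.
rewrite rev_cons cat_rcons.
exact: cox_equiv_trans (cox_equiv_square s (rev u) u) IHu.
Qed.

Lemma cox_equiv_revr u : cox_equiv (u ++ rev u) [::].
Proof. by have := cox_equiv_revl (rev u); rewrite revK. Qed.

Definition cox_one : coxeter_group := cox_word [::].
Definition cox_mul (x y : coxeter_group) : coxeter_group :=
  cox_word (repr x ++ repr y).
Definition cox_inv (x : coxeter_group) : coxeter_group :=
  cox_word (rev (repr x)).

Lemma repr_cox_word u : cox_equiv (repr (cox_word u)) u.
Proof. by apply/cox_wordP; rewrite {1}/cox_word reprK. Qed.

Lemma cox_word_repr x : cox_word (repr x) = x.
Proof. by rewrite /cox_word reprK. Qed.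

Lemma cox_mul_word u v : cox_mul (cox_word u) (cox_word v) = cox_word (u ++ v).
Proof. by apply/cox_wordP/cox_equiv_cat; apply: repr_cox_word. Qed.

Fact cox_mulA : associative cox_mul.
Proof.
move=> x y z; rewrite -(cox_word_repr x) -(cox_word_repr y) -(cox_word_repr z).
by rewrite !cox_mul_word catA.
Qed.

Fact cox_mul1g : left_id cox_one cox_mul.
Proof. by move=> x; rewrite -(cox_word_repr x) cox_mul_word. Qed.

Fact cox_mulg1 : right_id cox_one cox_mul.
Proof. by move=> x; rewrite -(cox_word_repr x) cox_mul_word cats0. Qed.

Fact cox_mulVg : left_inverse cox_one cox_inv cox_mul.
Proof.
move=> x; rewrite -{2}(cox_word_repr x) cox_mul_word.
by apply/cox_wordP/cox_equiv_revl.
Qed.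

Fact cox_mulgV : right_inverse cox_one cox_inv cox_mul.
Proof.
move=> x; rewrite -{1}(cox_word_repr x) cox_mul_word.
by apply/cox_wordP/cox_equiv_revr.
Qed.

HB.instance Definition _ := isGroup.Build coxeter_group
  cox_mulA cox_mul1g cox_mulg1 cox_mulVg cox_mulgV.

Lemma cox_word_cat u v : cox_word (u ++ v) = cox_word u * cox_word v.
Proof. by rewrite -cox_mul_word. Qed.

Definition cox_gen (s : S) : coxeter_group := cox_word [:: s].

Fact cox_length_subproof (w : coxeter_group) :
  exists l, `[< exists2 u, size u = l & cox_word u = w >].
Proof.
by exists (size (repr w)); apply/asboolP; exists (repr w); rewrite ?cox_word_repr.
Qed.

Definition cox_length (w : coxeter_group) : nat := ex_minn (cox_length_subproof w).

Definition reduced (u : seq S) : Prop := size u = cox_length (cox_word u).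

Definition left_descent (s : S) (w : coxeter_group) : Prop :=
  (cox_length (cox_gen s * w)%g < cox_length w)%N.
Definition right_descent (s : S) (w : coxeter_group) : Prop :=
  (cox_length (w * cox_gen s)%g < cox_length w)%N.

Definition reflection (t : coxeter_group) : Prop :=
  exists x s, t = x * cox_gen s * x^-1.

Definition bruhat_step (x y : coxeter_group) : Prop :=
  exists2 t, reflection t & y = x * t /\ (cox_length x < cox_length y)%N.

Definition bruhat_le (x y : coxeter_group) : bool :=
  `[< clos_refl_trans coxeter_group bruhat_step x y >].

Lemma bruhat_le_length x y :
  clos_refl_trans _ bruhat_step x y -> x = y \/ (cox_length x < cox_length y)%N.
Proof.
elim=> [{}x {}y [t _ [_ xy]]|{}x|{}x {}y z _ xy _ yz]; [by right|by left|].
case: xy yz => [-> //|xy] [<-|yz]; first by right.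
by right; apply: ltn_trans yz.
Qed.

Fact bruhat_le_refl : reflexive bruhat_le.
Proof. by move=> x; apply/asboolP; apply: rt_refl. Qed.

Fact bruhat_le_anti : antisymmetric bruhat_le.
Proof.
move=> x y /andP[/asboolP/bruhat_le_length[-> //|xy]].
by move=> /asboolP/bruhat_le_length[-> //|/(ltn_trans xy)]; rewrite ltnn.
Qed.

Fact bruhat_le_trans : transitive bruhat_le.
Proof.
move=> y x z /asboolP xy /asboolP yz; apply/asboolP.
exact: rt_trans xy yz.
Qed.

Fact bruhat_display : Order.disp_t. Proof. exact: Order.Disp tt tt. Qed.

HB.instance Definition _ := Order.Le_isPOrder.Build bruhat_display coxeter_group
  bruhat_le_refl bruhat_le_anti bruhat_le_trans.

Definition join_irreducible (w : coxeter_group) : Prop :=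
  ~ exists2 U : set coxeter_group, supremums U w & ~ U w.

Definition JI (i j : S) : set coxeter_group :=
  [set w | [/\ join_irreducible w, left_descent i w & right_descent j w]].

End CoxeterGroup.

Arguments JI {S} m i j.

Local Close Scope group_scope.

Definition is_chain {d} {T : porderType d} (A : set T) (s : seq T) : Prop :=
  A = [set` s] /\ sorted <%O s.

(* The nodes 0, 1, ..., n are the elements of ['I_n.+1]. *)
Definition coxB_order n (a b : 'I_n.+1) : nat :=
  if a == b then 1
  else if (a.+1 == b) || (b.+1 == a) then
    if (a == ord0) || (b == ord0) then 4 else 3
  else 2.

Fact coxB_order_diag n (a : 'I_n.+1) : coxB_order a a = 1.
Proof. by rewrite /coxB_order eqxx. Qed.

Fact coxB_order_offdiag n (a b : 'I_n.+1) : a != b -> coxB_order a b != 1.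
Proof. by rewrite /coxB_order => /negbTE->; do 2?[case: ifP => _]. Qed.

Fact coxB_order_sym n (a b : 'I_n.+1) : coxB_order a b = coxB_order b a.
Proof.
by rewrite /coxB_order eq_sym orbC; case: (a == ord0); case: (b == ord0).
Qed.

Definition coxB n : coxeter_matrix 'I_n.+1 :=
  CoxeterMatrix (@coxB_order_diag n) (@coxB_order_offdiag n) (@coxB_order_sym n).

(* Type D_(n+2): [inl true] is 0^+, [inl false] is 0^-, and [inr i] is the node
   i + 1, so that the nodes 1, ..., n are indexed by ['I_n]. *)
Definition nodeD n := (bool + 'I_n)%type.

Definition coxD_edge n (a b : nodeD n) : bool :=
  match a, b with
  | inl _, inl _ => false
  | inl _, inr i | inr i, inl _ => i == 0 :> nat
  | inr i, inr j => (i.+1 == j) || (j.+1 == i)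
  end.

Definition coxD_order n (a b : nodeD n) : nat :=
  if a == b then 1 else if coxD_edge a b then 3 else 2.

Fact coxD_order_diag n (a : nodeD n) : coxD_order a a = 1.
Proof. by rewrite /coxD_order eqxx. Qed.

Fact coxD_order_offdiag n (a b : nodeD n) : a != b -> coxD_order a b != 1.
Proof. by rewrite /coxD_order => /negbTE->; case: ifP. Qed.

Fact coxD_order_sym n (a b : nodeD n) : coxD_order a b = coxD_order b a.
Proof.
rewrite /coxD_order eq_sym; suff <- : coxD_edge a b = coxD_edge b a by [].
by case: a b => [?|i] [?|j] //=; rewrite orbC.
Qed.

Definition coxD n : coxeter_matrix (nodeD n) :=
  CoxeterMatrix (@coxD_order_diag n) (@coxD_order_offdiag n) (@coxD_order_sym n).

Definition path_word (a b : nat) : seq nat :=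
  if a <= b then iota a (b - a).+1 else rev (iota b (a - b).+1).

Definition b_word (k j : nat) : seq nat :=
  flatten [seq path_word i 0 | i <- iota 0 k] ++
  flatten [seq path_word (k + i) i.+1 | i <- iota 0 j].

(* All letters of [b_word k j] are at most k + j - 1, hence at most n for the
   values of k and j in use, so that [inord] is faithful on them. *)
Definition b_elt (n k j : nat) : coxeter_group (coxB n) :=
  cox_word (coxB n) [seq inord a | a <- b_word k j].

(* The sign [c] is the one given to the next occurrence of 0. *)
Fixpoint alternate n (c : bool) (u : seq 'I_n.+1) : seq (nodeD n) :=
  if u is a :: u' then
    if unlift ord0 a is Some i then inr i :: alternate c u'
    else inl c :: alternate (~~ c) u'
  else [::].

(* [phi true] is phi^+ and [phi false] is phi^-. Only meaningful on elements for
   which the result does not depend on the reduced word, such as join-irreducible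
   ones. *)
Definition phi n (c : bool) (b : coxeter_group (coxB n)) : coxeter_group (coxD n) :=
  cox_word (coxD n)
    (alternate c (xget [::] [set u | reduced (coxB n) u /\ cox_word (coxB n) u = b])).

Definition d_elt (n : nat) (c : bool) (k j : nat) : coxeter_group (coxD n) :=
  phi c (b_elt n k j).

(* Main.v *)
Require Import Defs.
From Stdlib Require Import Relation_Operators.
From mathcomp Require Import all_boot all_order.
From mathcomp Require Import boolp classical_sets.
From mathcomp Require Import zify.

Set Implicit Arguments.
Unset Strict Implicit.
Unset Printing Implicit Defensive.

Import Order.TTheory.

(** Let J be the set of all generators but 0^+, so that an element has no left
    descent other than 0^+ exactly when it is the shortest element of its coset in
    W_J \ W. These cosets are the orbit of a half-spin weight: sign patterns on
    the coordinates 0, ..., n + 1 with an even number of minus signs, on which the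
    generators act by exchanging neighbours, 0^+ also negating them. This action
    is minuscule, which is all that the general part of the proof needs from it
    ([minuscule_action]): the shortest representative of a state is the word that
    climbs to it, unique up to commutations ([climb_unique]); every element is a
    product of an element of W_J and such a representative ([coset_factor]), with
    additive lengths ([base_climb_reduced]); and the Bruhat order projects to the
    order on states generated by climbing ([coset_state_mono]).

    Join-irreducible elements have one left and one right descent only. This is
    Deodhar's criterion ([bruhat_le_prefixes]): an element is the join of its
    projections to the maximal parabolic quotients, each of which has at most one
    right descent. So the join-irreducible elements with left descent 0^+ are
    representatives of states with a unique descent. Conversely such a
    representative w is join-irreducible ([climb_join_irreducible]): all elements
    below w lie in cosets at most that of the unique state covered by the state of
    w, and this coset contains an upper bound of all of them.

    A sign pattern has a unique descent when its minus signs from coordinate 1 on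
    form one block j + 1, ..., j + k ([unique_down_interval]); coordinate 0 is then
    determined by parity, and so is the descent: it is j for j > 0, and for j = 0 it
    is 0^+ or 0^- as k is odd or even. Climbing from the block of length k to the one
    of length k + 1 gives the chains. The symmetry between 0^+ and 0^- is carried
    along as a parameter c, with [inl c] in the role of 0^+.

    It remains to see that d_k^{0j} is the representative of this block. In type B
    the word for b_k^{0j} takes the empty sign pattern on the coordinates
    1, ..., n + 1 to the block, climbing at each letter, and by length so does every
    reduced word for b_k^{0j}. A letter 0 climbs by creating a minus sign at
    coordinate 1; in type D this is done by 0^+ if coordinate 0 carries no minus
    sign and by 0^- otherwise, and either changes coordinate 0. Hence it is the
    alternating word that climbs in type D ([alternate_climbs]).

    The exchange and lifting properties behind this come from the parity with which
    a reflection occurs in a word ([inversionE]). *)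

(** * Words, lengths and reflections *)

Arguments cox_length {S m} w%_g.

Section CoxeterWords.
Local Open Scope group_scope.
Variables (S : choiceType) (m : coxeter_matrix S).
Implicit Types (s r : S) (u v a b : seq S) (t w x y z : coxeter_group m).

Local Notation cw := (cox_word m).
Local Notation g := (cox_gen m).
Local Notation len := cox_length.

Lemma cox_word_nil : cw [::] = 1.
Proof. by []. Qed.

Lemma cox_word_cons s u : cw (s :: u) = g s * cw u.
Proof. by rewrite -cat1s cox_word_cat. Qed.

Lemma cox_word_rcons u s : cw (rcons u s) = cw u * g s.
Proof. by rewrite -cats1 cox_word_cat. Qed.

Lemma cox_word_rev u : cw (rev u) = (cw u)^-1.
Proof.
apply: (@mulgI _ (cw u)); rewrite mulgV -cox_word_cat -cox_word_nil.
exact/cox_wordP/cox_equiv_revr.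
Qed.

Lemma cox_gen_sq s : g s * g s = 1.
Proof.
rewrite -cox_word_cat -cox_word_nil; apply/cox_wordP.
exact: (cox_equiv_square m s [::] [::]).
Qed.

Lemma cox_gen_inv s : (g s)^-1 = g s.
Proof. by apply: (@mulgI _ (g s)); rewrite mulgV cox_gen_sq. Qed.

Lemma cox_genK s x : g s * (g s * x) = x.
Proof. by rewrite mulgA cox_gen_sq mul1g. Qed.

Lemma cox_genKr s x : x * g s * g s = x.
Proof. by rewrite -mulgA cox_gen_sq mulg1. Qed.

Lemma cox_length_word u : (len (cw u) <= size u)%N.
Proof.
rewrite /cox_length; case: ex_minnP => l _; apply.
by apply/asboolP; exists u.
Qed.

Lemma reduced_word w : exists2 u, reduced m u & cw u = w.
Proof.
have: exists2 u, size u = len w & cw u = w.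
  by rewrite /cox_length; case: ex_minnP => l /asboolP.
by case=> u szu cwu; exists u => //; rewrite /reduced cwu.
Qed.

Lemma cox_length1 : len (1 : coxeter_group m) = 0%N.
Proof. by apply/eqP; rewrite -leqn0; apply: (cox_length_word [::]). Qed.

Lemma cox_lengthM x y : (len (x * y) <= len x + len y)%N.
Proof.
have [[u ru <-] [v rv <-]] := (reduced_word x, reduced_word y).
by rewrite -cox_word_cat -ru -rv -size_cat cox_length_word.
Qed.

Lemma cox_lengthV x : len x^-1 = len x.
Proof.
suff le y : (len y^-1 <= len y)%N.
  by apply/eqP; rewrite eqn_leq le; rewrite -{1}(invgK x) le.
have [u ru <-] := reduced_word y.
by rewrite -cox_word_rev -ru -(size_rev u) cox_length_word.
Qed.

Lemma cox_length_gen s : (len (g s) <= 1)%N.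
Proof. exact: (cox_length_word [:: s]). Qed.

Lemma cox_length_gen_mul s x : (len (g s * x) <= (len x).+1)%N.
Proof. by apply: leq_trans (cox_lengthM _ _) _; have := cox_length_gen s; lia. Qed.

Lemma reduced_catl a b : reduced m (a ++ b) -> reduced m a.
Proof.
rewrite /reduced size_cat cox_word_cat => ab.
have := (cox_lengthM (cw a) (cw b), cox_length_word a, cox_length_word b).
by case=> -[]; lia.
Qed.

Lemma reduced_catr a b : reduced m (a ++ b) -> reduced m b.
Proof.
rewrite /reduced size_cat cox_word_cat => ab.
have := (cox_lengthM (cw a) (cw b), cox_length_word a, cox_length_word b).
by case=> -[]; lia.
Qed.

(** The reflections p s p^-1, one for each factorisation u = p ++ s :: q. *)
Fixpoint word_reflections u : seq (coxeter_group m) :=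
  if u is s :: u' then g s :: [seq g s * t * (g s)^-1 | t <- word_reflections u']
  else [::].

Lemma word_reflections_cat u v :
  word_reflections (u ++ v) =
  word_reflections u ++ [seq cw u * t * (cw u)^-1 | t <- word_reflections v].
Proof.
elim: u => [|s u IHu] /=.
  by rewrite -[LHS]map_id; apply: eq_map => t; rewrite cox_word_nil invg1 mul1g mulg1.
rewrite IHu map_cat -map_comp; congr (_ :: _ ++ _); apply: eq_map => t /=.
by rewrite cox_word_cons invgM !mulgA.
Qed.

(** Only the parity survives the Coxeter relations, which insert or remove
    reflections in pairs. *)
Definition reflection_parity u t := odd (count_mem t (word_reflections u)).

Lemma reflection_parity_cat u v t :
  reflection_parity (u ++ v) t =
  reflection_parity u t (+) reflection_parity v ((cw u)^-1 * t * cw u).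
Proof.
rewrite /reflection_parity word_reflections_cat count_cat oddD; congr (_ (+) odd _).
rewrite count_map; apply: eq_count => r /=.
apply/eqP/eqP => [<-|->]; first by rewrite !mulgA mulVg mul1g mulgVK.
by rewrite !mulgA mulgV mul1g mulgK.
Qed.

Lemma word_reflections_relator s r k :
  word_reflections (flatten (nseq k [:: s; r])) =
  [seq (g s * g r) ^+ i * g s | i <- iota 0 (k + k)].
Proof.
elim: k => [|k IHk] //=.
rewrite addnS /= expg0 mul1g expg1 IHk cox_gen_inv; congr [:: _, _ & _].
rewrite -!map_comp (iotaDl 2 0) -map_comp; apply: eq_map => i /=.
rewrite !cox_gen_inv add2n expgSr expgS !mulgA.
by rewrite -!(mulgA _ (g s) (g r)).
Qed.

Lemma cox_word_relator s r : cw (flatten (nseq (m s r) [:: s; r])) = 1.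
Proof.
apply/cox_wordP; have := cox_equiv_relator m s r [::] [::].
by rewrite cats0.
Qed.

Lemma cox_word_flatten k s r :
  cw (flatten (nseq k [:: s; r])) = (g s * g r) ^+ k.
Proof.
by elim: k => //= k IHk; rewrite !cox_word_cons IHk expgS mulgA.
Qed.

(** As (s r)^m = 1, the 2m reflections of a relator are the first m of them,
    each listed twice. *)
Lemma reflection_parity_relator s r t :
  reflection_parity (flatten (nseq (m s r) [:: s; r])) t = false.
Proof.
rewrite /reflection_parity word_reflections_relator iotaD map_cat count_cat.
suff -> : [seq (g s * g r) ^+ i * g s | i <- iota (0 + m s r) (m s r)] =
          [seq (g s * g r) ^+ i * g s | i <- iota 0 (m s r)].
  by rewrite oddD addbb.
rewrite add0n -{1}(addn0 (m s r)) iotaDl -map_comp; apply: eq_map => i /=.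
by rewrite expgnDr -(cox_word_flatten (m s r)) cox_word_relator mul1g.
Qed.

Lemma reflection_parity_equiv u v t :
  cox_equiv m u v -> reflection_parity u t = reflection_parity v t.
Proof.
move=> uv; elim: uv t => [s r x y t|//|x y _ IH t|x y z _ IHxy _ IHyz t].
- rewrite !reflection_parity_cat reflection_parity_relator cox_word_relator.
  by rewrite invg1 mul1g mulg1.
- by rewrite IH.
- by rewrite IHxy.
Qed.

Definition inversion_parity w t := reflection_parity (repr w) t.

Lemma inversion_parity_word u t : inversion_parity (cw u) t = reflection_parity u t.
Proof. exact/reflection_parity_equiv/repr_cox_word. Qed.

Lemma inversion_parityM x y t :
  inversion_parity (x * y) t = inversion_parity x t (+) inversion_parity y (x^-1 * t * x).
Proof.
have [[u <-] [v <-]] := (cox_word_surj x, cox_word_surj y).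
by rewrite -cox_word_cat !inversion_parity_word reflection_parity_cat.
Qed.

Lemma inversion_parity1 t : inversion_parity 1 t = false.
Proof. by rewrite -cox_word_nil inversion_parity_word. Qed.

Lemma inversion_parity_gen s t : inversion_parity (g s) t = (t == g s).
Proof.
rewrite inversion_parity_word /reflection_parity /= addn0 eq_sym.
by case: eqP.
Qed.

(** For t = x s x^-1 the contributions of x and of x^-1 cancel, which leaves the
    one of s. *)
Lemma inversion_parity_reflection t : reflection t -> inversion_parity t t.
Proof.
case=> x [s ->]; rewrite !inversion_parityM inversion_parity_gen.
have := inversion_parity1 (x * g s * x^-1).
rewrite -{1}(mulgV x) inversion_parityM invgM cox_gen_inv.
set p := inversion_parity x _.
have -> : x^-1 * (x * g s * x^-1) * x = g s by rewrite !mulgA mulVg mul1g mulgVK.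
have -> : g s * x^-1 * (x * g s * x^-1) * (x * g s) = g s.
  by rewrite !mulgA mulgVK mulgVK cox_gen_sq mul1g.
by rewrite eqxx; case: p; case: inversion_parity.
Qed.

Lemma mem_word_reflections t u : t \in word_reflections u ->
  exists p s q, u = p ++ s :: q /\ t * cw u = cw (p ++ q).
Proof.
elim: u t => //= s u IHu t; rewrite inE => /orP[/eqP->|/mapP[r /IHu[p [s' [q [-> ru]]]] ->]].
  by exists [::], s, u; rewrite cox_word_cons cox_genK.
exists (s :: p), s', q; split=> //.
by rewrite /= !cox_word_cons !mulgA mulgVK -ru !mulgA.
Qed.

Lemma inversion_exchange t u : inversion_parity (cw u) t ->
  exists p s q, u = p ++ s :: q /\ t * cw u = cw (p ++ q).
Proof.
rewrite inversion_parity_word /reflection_parity => odd_t.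
by apply: mem_word_reflections; rewrite -has_pred1 has_count; case: count odd_t.
Qed.

Lemma reflectionJ t x : reflection t -> reflection (x * t * x^-1).
Proof.
by case=> y [s ->]; exists (x * y), s; rewrite invgM !mulgA.
Qed.

Lemma reflection_gen s : reflection (g s).
Proof. by exists 1, s; rewrite invg1 mulg1 mul1g. Qed.

Lemma reflection_sq t : reflection t -> t * t = 1.
Proof.
by case=> x [s ->]; rewrite !mulgA mulgVK cox_genKr mulgV.
Qed.

Lemma inversion_length t x : inversion_parity x t -> (len (t * x) < len x)%N.
Proof.
have [u ru <-] := reduced_word x.
move=> /inversion_exchange[p [s [q [eu ->]]]].
rewrite -ru eu; apply: leq_ltn_trans (cox_length_word _) _.
by rewrite !size_cat /= addnS.
Qed.

(** The number of times a reflection t occurs in a word for x is odd exactly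
    when t shortens x: an occurrence lets one delete a letter, and replacing x
    by t x flips the parity. *)
Lemma inversionE t x : reflection t -> (len (t * x) < len x)%N = inversion_parity x t.
Proof.
move=> rt; apply/idP/idP => [lt|]; last exact: inversion_length.
apply/negP => /negP nxt; suff /inversion_length: inversion_parity (t * x) t.
  by rewrite mulgA reflection_sq // mul1g; lia.
rewrite inversion_parityM inversion_parity_reflection //.
have -> : t^-1 * t * t = t by rewrite mulVg mul1g.
by rewrite (negbTE nxt).
Qed.

Lemma ninversionE t x : reflection t -> (len x < len (t * x))%N = ~~ inversion_parity x t.
Proof.
move=> rt; rewrite -{1}[x]mul1g -(reflection_sq rt) -mulgA inversionE //.
rewrite inversion_parityM inversion_parity_reflection //.
by rewrite mulVg mul1g addTb.
Qed.

Lemma strong_exchange t u : reflection t -> (len (t * cw u) < len (cw u))%N ->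
  exists p s q, u = p ++ s :: q /\ t * cw u = cw (p ++ q).
Proof. by move=> rt; rewrite inversionE // => /inversion_exchange. Qed.

Lemma cox_length_gen_neq s x : len (g s * x) != len x.
Proof.
have rs := reflection_gen s; rewrite neq_ltn inversionE // ninversionE //.
exact: orbN.
Qed.

Lemma cox_length_gen_down s x :
  (len (g s * x) < len x)%N -> len x = (len (g s * x)).+1.
Proof. by move=> lt; have := cox_length_gen_mul s (g s * x); rewrite cox_genK; lia. Qed.

Lemma cox_length_gen_up s x :
  ~~ (len (g s * x) < len x)%N -> len (g s * x) = (len x).+1.
Proof.
move=> nlt; have := cox_length_gen_mul s x; have := cox_length_gen_neq s x.
by lia.
Qed.

(** A letter that does not lengthen a reduced word cancels one of its letters. *)
Lemma reduced_subword u :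
  exists v, [/\ reduced m v, cw v = cw u & {subset v <= u}].
Proof.
elim: u => [|s u [v [rv cv sv]]].
  by exists [::]; split=> //; rewrite /reduced cox_word_nil cox_length1.
have sub p : {subset p <= v} -> {subset p <= s :: u}.
  by move=> pv r /pv/sv; rewrite inE orbC => ->.
have [lt|nlt] := boolP (len (g s * cw v) < len (cw v))%N.
  have [p [r [q [ev epq]]]] := strong_exchange (reflection_gen s) lt.
  exists (p ++ q); split.
  - have := cox_length_gen_down lt; rewrite /reduced -epq -rv ev !size_cat /=; lia.
  - by rewrite -epq cox_word_cons cv.
  - by apply: sub => x; rewrite ev !mem_cat inE => /orP[]->; rewrite ?orbT.
exists (s :: v); split.
- by rewrite /reduced cox_word_cons (cox_length_gen_up nlt) -rv.
- by rewrite !cox_word_cons cv.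
- by move=> x; rewrite !inE => /predU1P[->|/sv->]; rewrite ?eqxx ?orbT.
Qed.

End CoxeterWords.

(** * The Bruhat order and its join-irreducible elements *)

Section BruhatOrder.
Local Open Scope group_scope.
Variables (S : choiceType) (m : coxeter_matrix S).
Implicit Types (s r : S) (u v a b : seq S) (t w x y z : coxeter_group m).

Local Notation cw := (cox_word m).
Local Notation g := (cox_gen m).
Local Notation len := cox_length.

Lemma bruhat_reflection t x :
  reflection t -> (len x < len (t * x))%N -> (x <= t * x)%O.
Proof.
move=> rt lt; apply/asboolP/rt_step; exists (x^-1 * t * x).
  by have := reflectionJ x^-1 rt; rewrite invgK.
by rewrite !mulgA mulgV mul1g.
Qed.

Lemma bruhat_ind (P : coxeter_group m -> coxeter_group m -> Prop) :
  (forall x, P x x) -> (forall x y z, P x y -> P y z -> P x z) ->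
  (forall t x, reflection t -> (len x < len (t * x))%N -> P x (t * x)) ->
  forall x y, (x <= y)%O -> P x y.
Proof.
move=> Pxx Ptrans Pstep x y /asboolP.
elim=> [{}x {}y [t rt [-> lt]]|//|{}x {}y z _ xy _ yz]; last exact: Ptrans xy yz.
have e : x * t = (x * t * x^-1) * x by rewrite mulgVK.
by rewrite e; apply: Pstep; rewrite -?e //; apply: reflectionJ.
Qed.

Lemma bruhat_length x y : (x <= y)%O -> x = y \/ (len x < len y)%N.
Proof. by move=> /asboolP/bruhat_le_length. Qed.

Lemma bruhat_genW s x : (len (g s * x) < len x)%N -> (g s * x <= x)%O.
Proof.
move=> lt; rewrite -{2}(cox_genK s x); apply: bruhat_reflection.
  exact: reflection_gen.
by rewrite cox_genK.
Qed.

Lemma bruhat_le_gen s x : (len x < len (g s * x))%N -> (x <= g s * x)%O.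
Proof. by move=> lt; apply: bruhat_reflection => //; apply: reflection_gen. Qed.

Lemma bruhat_inv x y : (x <= y)%O -> (x^-1 <= y^-1)%O.
Proof.
apply: (bruhat_ind (P := fun x y => (x^-1 <= y^-1)%O)) => // [{}x {}y z|t {}x rt lt].
  exact: le_trans.
apply/asboolP/rt_step; exists t => //; split; last by rewrite !cox_lengthV.
by rewrite invgM; congr (_ * _); apply: (@mulgI _ t); rewrite mulgV reflection_sq.
Qed.

(** Left multiplication by s only changes the inversion parity of s itself.
    Hence, for t <> s, the step from s x to s t x by the reflection s t s ascends
    like the step from x to t x by t, whatever s does to x and to t x. *)
Lemma bruhat_gen_mul_step s t x : reflection t -> (len x < len (t * x))%N ->
  t = g s \/ (g s * x <= g s * (t * x))%O.
Proof.
move=> rt lt; have [->|ts] := eqVneq t (g s); [by left|right].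
have rt' := reflectionJ (g s) rt.
have -> : g s * (t * x) = (g s * t * (g s)^-1) * (g s * x).
  by rewrite !mulgA mulgVK.
apply: bruhat_reflection => //; rewrite ninversionE // inversion_parityM.
have -> : (g s)^-1 * (g s * t * (g s)^-1) * g s = t.
  by rewrite !mulgA mulVg mul1g mulgVK.
rewrite inversion_parity_gen negb_add; move: lt; rewrite ninversionE // => /negbTE->.
rewrite eqbF_neg; apply: contra ts => /eqP e.
by apply/eqP/(@mulgI _ (g s))/(@mulIg _ (g s)^-1); rewrite e cox_gen_sq mul1g cox_gen_inv.
Qed.

(** Along a chain of steps the three statements have to be proved together: where
    a step yields only the first alternative, the chain goes on by x <= y. *)
Lemma bruhat_gen_mul s x y : (x <= y)%O ->
  [/\ (x <= y)%O, (g s * x <= y)%O \/ (g s * x <= g s * y)%O &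
      (x <= g s * y)%O \/ (g s * x <= g s * y)%O].
Proof.
move: x y; apply: bruhat_ind => [x|x y z [xy xy1 xy2] [yz yz1 yz2]|t x rt lt].
- by split=> //; right.
- split; first exact: le_trans yz.
    case: xy1 => [xy1|xy1]; first by left; apply: le_trans yz.
    by case: yz1 => yz1; [left|right]; apply: le_trans yz1.
  case: yz2 => yz2; first by left; apply: le_trans yz2.
  by case: xy2 => xy2; [left|right]; apply: le_trans yz2.
- have xy := bruhat_reflection rt lt; split=> //.
    case: (bruhat_gen_mul_step s rt lt) => [e|]; [left|by right].
    by rewrite e.
  case: (bruhat_gen_mul_step s rt lt) => [e|]; [left|by right].
  by rewrite e cox_genK.
Qed.

Lemma bruhat_lift s x y :
  (x <= y)%O -> (len (g s * y) < len y)%N -> (g s * x <= y)%O.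
Proof.
move=> xy /bruhat_genW lt; have [_ [//|le] _] := bruhat_gen_mul s xy.
exact: le_trans lt.
Qed.

Lemma bruhat_drop s x y :
  (x <= y)%O -> (len x < len (g s * x))%N -> (x <= g s * y)%O.
Proof.
move=> xy /bruhat_le_gen lt; have [_ _ [//|le]] := bruhat_gen_mul s xy.
exact: le_trans le.
Qed.

Lemma bruhat_prefix a b : reduced m (a ++ b) -> (cw a <= cw (a ++ b))%O.
Proof.
move=> rab; rewrite cox_word_cat -[cw a]invgK -[cw b]invgK -invgM.
apply: bruhat_inv; rewrite -!cox_word_rev.
have {rab}: reduced m (rev b ++ rev a).
  by rewrite /reduced -rev_cat cox_word_rev cox_lengthV size_rev.
elim: (rev b) => [|s u IHu] rsu; first by rewrite cox_word_nil mul1g.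
apply: le_trans (IHu _) _; first exact: (reduced_catr (a := [:: s])).
rewrite cox_word_cons -mulgA; apply: bruhat_le_gen.
rewrite -(cox_word_cat m u) -cox_word_cons -rsu.
by rewrite -(reduced_catr (a := [:: s]) rsu).
Qed.

Lemma ex_left_descent w : w <> 1 -> exists s, (len (g s * w) < len w)%N.
Proof.
have [[|s u] ru <-] := reduced_word w; first by rewrite cox_word_nil.
move=> _; exists s; rewrite cox_word_cons cox_genK -cox_word_cons -ru.
by rewrite -(reduced_catr (a := [:: s]) ru).
Qed.

End BruhatOrder.

Section BruhatJoins.
Local Open Scope group_scope.
Variables (S : choiceType) (m : coxeter_matrix S).
Hypothesis cox_gen_inj : injective (cox_gen m).
Implicit Types (s r : S) (u v a b : seq S) (t w x y z : coxeter_group m).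

Local Notation cw := (cox_word m).
Local Notation g := (cox_gen m).
Local Notation len := cox_length.

Lemma mem_cox_word_gen s u : cw u = g s -> s \in u.
Proof.
move=> us; have [[|r [|r' v]] [rv cv sv]] := reduced_subword m u.
- have := cox_length_gen_neq s (1 : coxeter_group m).
  by rewrite mulg1 -us -cv cox_word_nil eqxx.
- by move: cv; rewrite us => /cox_gen_inj <-; apply: sv; rewrite mem_head.
- by have := cox_length_gen m s; rewrite -us -cv -rv.
Qed.

(** If w had a last letter s, then w s would arise by deleting a letter from a
    word for w that avoids s, making s a product of other generators. *)
Lemma avoid_all_letters w :
  (forall s, exists2 u, cw u = w & s \notin u) -> w = 1.
Proof.
move=> av; have [->//|nw1] := EM (w = 1).
have [s lt] : exists s, (len (g s * w^-1) < len w^-1)%N.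
  by apply: ex_left_descent => e; apply: nw1; rewrite -(invgK w) e invg1.
have [u uw su] := av s; move: lt; rewrite -uw -cox_word_rev.
move=> /(strong_exchange (reflection_gen m s))[p [r [q [eu spq]]]].
suff : s \in (p ++ q) ++ u.
  rewrite mem_cat (negbTE su) orbF => sp; case/negP: su.
  by move: sp; rewrite -(mem_rev u) eu !mem_cat inE => /orP[]->; rewrite ?orbT.
by apply: mem_cox_word_gen; rewrite cox_word_cat -spq cox_word_rev mulgVK.
Qed.

(** An exchange on a concatenation happens in one of the two factors, as
    inversion parities add up. *)
Lemma exchange_cat t a b :
    reflection t -> (len (t * cw (a ++ b)) < len (cw (a ++ b)))%N ->
  (exists p s q, a = p ++ s :: q /\ t * cw a = cw (p ++ q)) \/
  (exists p s q, b = p ++ s :: q /\ t * cw (a ++ b) = cw (a ++ p ++ q)).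
Proof.
move=> rt; rewrite inversionE // cox_word_cat inversion_parityM.
have [/inversion_exchange|na /=] := boolP (inversion_parity (cw a) t); first by left.
move=> /inversion_exchange[p [s [q [eb epq]]]]; right; exists p, s, q; split=> //.
by rewrite (cox_word_cat m a) -epq !mulgA mulgV mul1g.
Qed.

(** Deodhar's criterion, with prefixes in place of the projections to the maximal
    parabolic quotients. Let s be a left descent of z. If s is a left descent of w
    too, then s w has prefixes at most those of w, so s w <= z by induction and
    the lifting property gives w <= z. Otherwise s lengthens all prefixes of w, so
    they stay below s z. *)
Lemma bruhat_le_prefixes w z :
  (forall s, exists a b, [/\ reduced m (a ++ b), cw (a ++ b) = w,
                             s \notin b & (cw a <= z)%O]) ->
  (w <= z)%O.
Proof.
have [k] := ubnP (len z + len w); elim: k => // k IHk in w z *.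
rewrite ltnS => wzk pre.
have [z1|/ex_left_descent[s sz]] := EM (z = 1).
  suff -> : w = 1 by rewrite z1.
  apply: avoid_all_letters => s; have [a [b [_ <- sb az]]] := pre s.
  exists b => //; suff -> : cw (a ++ b) = cw b by [].
  rewrite cox_word_cat; suff -> : cw a = 1 by rewrite mul1g.
  by case: (bruhat_length az) => [->//|]; rewrite z1 cox_length1.
have [sw|nsw] := boolP (len (g s * w) < len w)%N.
  suff le : (g s * w <= z)%O by rewrite -(cox_genK s w); apply: bruhat_lift.
  apply: IHk => [|r]; first by lia.
  have [a [b [rab cab rb az]]] := pre r.
  have lt : (len (g s * cw (a ++ b)) < len (cw (a ++ b)))%N by rewrite cab.
  have := cox_length_gen_down lt.
  have [[p [r' [q [ea spq]]]]|[p [r' [q [eb spq]]]]] :=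
    exchange_cat (reflection_gen m s) lt.
    (* the deleted letter comes from a, so the new prefix is s a < a *)
    move=> len_eq; have pq : cw ((p ++ q) ++ b) = g s * w.
      by rewrite (cox_word_cat m (p ++ q)) -spq -mulgA -(cox_word_cat m a) cab.
    exists (p ++ q), b; split=> //.
      by move: rab len_eq; rewrite /reduced pq cab ea !size_cat /=; lia.
    rewrite -spq; apply: le_trans az; apply: bruhat_genW.
    rewrite spq -(reduced_catl rab).
    by rewrite ea; have := cox_length_word m (p ++ q); rewrite !size_cat /=; lia.
  move=> len_eq; exists a, (p ++ q); split=> //.
  - by move: rab len_eq; rewrite /reduced -spq cab eb !size_cat /=; lia.
  - by rewrite -spq cab.
  - by apply: contra rb; rewrite eb !mem_cat inE => /orP[]->; rewrite ?orbT.
apply: le_trans (bruhat_genW sz); apply: IHk => [|r]; first by lia.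
have [a [b [rab cab rb az]]] := pre r; exists a, b; split=> //.
apply: bruhat_drop => //; rewrite ltnNge; apply: contra nsw => le.
rewrite -cab cox_word_cat mulgA; apply: leq_ltn_trans (cox_lengthM _ _) _.
move: le (cox_length_gen_neq s (cw a)) (reduced_catl rab) (reduced_catr rab) (rab).
rewrite /reduced size_cat cox_word_cat => le neq ra eb <-.
by rewrite -eb ltn_add2r ra ltn_neqAle neq.
Qed.

(** Grouping the letters other than s into the longest possible suffix leaves a
    prefix whose only right descent can be s; by [bruhat_le_prefixes] w is the
    join of these prefixes, hence one of them when it is join-irreducible. *)
Lemma join_irreducible_right_descent w : join_irreducible w ->
  exists s, forall r, right_descent r w -> r = s.
Proof.
move=> jw.
pose fact s a := exists b, [/\ reduced m (a ++ b), cw (a ++ b) = w & s \notin b].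
pose minfact s a := fact s a /\ forall a', fact s a' -> (size a <= size a')%N.
have exfact s : exists a, minfact s a.
  have ex : exists l, `[< exists2 a, size a = l & fact s a >].
    have [u ru uw] := reduced_word w; exists (size u); apply/asboolP.
    by exists u => //; exists [::]; rewrite cats0.
  case: (ex_minnP ex) => l /asboolP[a <- fa] mina; exists a; split=> // a' fa'.
  by apply: mina; apply/asboolP; exists a'.
pose U : set (coxeter_group m) := fun x => exists s a, minfact s a /\ x = cw a.
have supU : supremums U w.
  split=> [_ [s [a [[[b [rab <- _]] _] ->]]]|z ubz]; first exact: bruhat_prefix.
  apply: bruhat_le_prefixes => s; have [a ma] := exfact s.
  have [[b [rab abw sb]] _] := ma; exists a, b; split=> //.
  by apply: ubz; exists s, a.
have [s [a [[[b [rab abw sb]] mina] wa]]] : U w.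
  by apply: contrapT => nU; apply: jw; exists U.
exists s => r; rewrite /right_descent -{1}cox_lengthV invgM cox_gen_inv -(cox_lengthV w).
have ra := reduced_catl rab.
rewrite wa -cox_word_rev.
move=> /(strong_exchange (reflection_gen m r))[p [r' [q [epq rpq]]]].
apply: contrapT => /eqP nrs.
suff : (size a <= size (rev (p ++ q)))%N.
  by rewrite -(size_rev a) epq size_rev !size_cat /= addnS ltnn.
have e : cw (rcons (rev (p ++ q)) r) = w.
  rewrite cox_word_rcons cox_word_rev -rpq invgM cox_gen_inv cox_word_rev invgK.
  by rewrite cox_genKr.
apply: mina; exists [:: r]; rewrite cats1; split=> //; last by rewrite inE eq_sym.
rewrite /reduced e wa -ra -(size_rev a) epq size_rcons size_rev !size_cat /=; lia.
Qed.

Lemma join_irreducible_inv w : join_irreducible w -> join_irreducible w^-1.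
Proof.
move=> jw [U [ubU lbU] nU]; apply: jw.
exists (fun x => U x^-1) => //; split=> [x /ubU/bruhat_inv|z ubz].
  by rewrite !invgK.
rewrite -[w]invgK -[z]invgK; apply: bruhat_inv; apply: lbU => x Ux.
by rewrite -[x]invgK; apply: bruhat_inv; apply: ubz; rewrite invgK.
Qed.

Lemma left_descentV s w : left_descent s w <-> right_descent s w^-1.
Proof.
by rewrite /left_descent /right_descent -(cox_lengthV (g s * w)) invgM cox_gen_inv cox_lengthV.
Qed.

Lemma join_irreducible_left_descent w : join_irreducible w ->
  exists s, forall r, left_descent r w -> r = s.
Proof.
move=> /join_irreducible_inv/join_irreducible_right_descent[s sV].
by exists s => r /left_descentV/sV.
Qed.

End BruhatJoins.

(** * Minuscule actions *)

(** The action of a Coxeter group on the cosets of a parabolic subgroup, in the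
    minuscule case, with the length of the shortest representative as [rank]. The
    last three axioms restrict the nontrivial orbits of two letters: they are chains
    of three states unless the letters commute. This is what makes shortest
    representatives unique up to commutations, and what moves a letter that fixes
    a state to a letter that fixes the base. *)
Record minuscule_action (S : choiceType) (m : coxeter_matrix S) := MinusculeAction {
  state :> Type;
  act : state -> S -> state;
  rank : state -> nat;
  base : state;
  act_relator : forall s t x, foldl act x (flatten (nseq (m s t) [:: s; t])) = x;
  rank_base : rank base = 0;
  act_rank : forall x s, [\/ act x s = x, rank (act x s) = (rank x).+1
                           | rank x = (rank (act x s)).+1];
  act_down2 : forall x s t, s != t ->
    rank (act x s) < rank x -> rank (act x t) < rank x ->
    m s t = 2 /\ rank (act (act x s) t) < rank (act x s);
  act_up2 : forall x s t, s != t ->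
    rank x < rank (act x s) -> rank x < rank (act x t) ->
    m s t = 2 /\ rank (act x s) < rank (act (act x s) t);
  act_down_fix : forall x s t, rank (act x s) < rank x -> act x t = x ->
    m s t = 2 \/ m s t = 3 /\ rank (act (act x s) t) < rank (act x s)
}.

Section MinusculeAction.
Variables (S : choiceType) (m : coxeter_matrix S) (X : minuscule_action m).
Implicit Types (s r : S) (u v a b p q : seq S) (x y z : X) (w t : coxeter_group m).

Local Notation cw := (cox_word m).
Local Notation g := (cox_gen m).
Local Notation len := cox_length.
Local Notation base := (base X).

Definition run x u := foldl (@act S m X) x u.

(** A letter raises the rank by at most 1, so this equation says that every letter
    of u raises it. *)
Definition climbs x u := rank (run x u) = rank x + size u.

Lemma run_cat x u v : run x (u ++ v) = run (run x u) v.
Proof. exact: foldl_cat. Qed.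

Lemma run_rcons x u s : run x (rcons u s) = act (run x u) s.
Proof. by rewrite -cats1 run_cat. Qed.

Lemma run_equiv x u v : cox_equiv m u v -> run x u = run x v.
Proof.
move=> uv; elim: uv x => [s r p q x|//|p q _ IH x|p q z _ IHpq _ IHqz x].
- by rewrite !run_cat [run (run x p) _]act_relator.
- by rewrite IH.
- by rewrite IHpq.
Qed.

Lemma run_word x u v : cw u = cw v -> run x u = run x v.
Proof. by move=> /cox_wordP; apply: run_equiv. Qed.

Definition coset_state w := run base (repr w).

Lemma coset_state_word u : coset_state (cw u) = run base u.
Proof. exact/run_equiv/repr_cox_word. Qed.

Lemma actK s x : act (act x s) s = x.
Proof. by have := act_relator s s x; rewrite cox_order_diag. Qed.

Lemma act_inj s : injective ((@act S m X)^~ s).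
Proof. exact: inv_inj (actK s). Qed.

Lemma actC s r x : m s r = 2 -> act (act x s) r = act (act x r) s.
Proof.
move=> sr; rewrite cox_order_sym in sr.
by have := act_relator r s (act (act x s) r); rewrite sr /= !actK => <-.
Qed.

Lemma act_braid s r x : m s r = 3 ->
  act (act (act x s) r) s = act (act (act x r) s) r.
Proof.
move=> sr; apply: (@act_inj r); apply: (@act_inj s); apply: (@act_inj r); rewrite !actK.
by have := act_relator s r x; rewrite sr.
Qed.

Lemma rank_down x s : rank (act x s) < rank x -> rank x = (rank (act x s)).+1.
Proof. by case: (act_rank x s) => [->|->|//]; lia. Qed.

Lemma rank_up x s : rank x < rank (act x s) -> rank (act x s) = (rank x).+1.
Proof. by case: (act_rank x s) => [->|//|->]; lia. Qed.

Lemma rank_act_le x s : rank (act x s) <= (rank x).+1.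
Proof. by case: (act_rank x s) => [->|->|->]; lia. Qed.

Lemma rank_run_le x u : rank (run x u) <= rank x + size u.
Proof.
elim: u x => [|s u IHu] x /=; first by rewrite addn0.
by apply: leq_trans (IHu _) _; have := rank_act_le x s; lia.
Qed.

Lemma climbs_cat x u v : climbs x (u ++ v) <-> climbs x u /\ climbs (run x u) v.
Proof.
rewrite /climbs run_cat size_cat.
have le1 := rank_run_le x u; have le2 := rank_run_le (run x u) v.
by split=> [|[]]; lia.
Qed.

Lemma climbs_rcons x u s :
  climbs x (rcons u s) <-> climbs x u /\ rank (run x u) < rank (act (run x u) s).
Proof.
rewrite -cats1 climbs_cat /climbs /= addn1.
by split=> [[e ->]|[e /rank_up->]].
Qed.

Lemma climbs_cons x s u :
  climbs x (s :: u) <-> rank x < rank (act x s) /\ climbs (act x s) u.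
Proof.
rewrite -cat1s climbs_cat /climbs /= addn1.
by split=> [[-> e]|[/rank_up-> e]].
Qed.

Lemma size_climb v : climbs base v -> size v = rank (run base v).
Proof. by rewrite /climbs rank_base. Qed.

(** Besides the last letter r of u, any other descent s of the final state commutes
    with r, so it can be moved in front of r. *)
Lemma climb_down u s : climbs base u ->
    rank (act (run base u) s) < rank (run base u) ->
  exists2 v, climbs base v & run base v = act (run base u) s.
Proof.
elim/last_ind: u s => [|u r IHu] s; first by rewrite rank_base.
rewrite run_rcons climbs_rcons => -[cu up_r] down_s.
have [<-|nrs] := eqVneq r s; first by exists u; rewrite ?actK.
have down_r : rank (act (act (run base u) r) r) < rank (act (run base u) r).
  by rewrite actK.
have [rs] := act_down2 nrs down_r down_s; rewrite actK => down_rs.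
have [v cv ev] := IHu s cu down_rs.
have ev' : run base (rcons v r) = act (act (run base u) r) s.
  by rewrite run_rcons ev actC // cox_order_sym.
exists (rcons v r) => //; rewrite climbs_rcons; split=> //.
rewrite -run_rcons ev' ev.
move: (rank_down down_rs) (rank_down down_s) (rank_up up_r); lia.
Qed.

Lemma cox_genC s r : m s r = 2 -> (g s * g r = g r * g s)%g.
Proof.
move=> sr; have := cox_word_relator m s r.
rewrite sr cox_word_flatten expg2 => /mulg1_eq <-.
by rewrite invgM !cox_gen_inv.
Qed.

Lemma cox_gen_braid s r : m s r = 3 -> (g s * g r * g s = g r * g s * g r)%g.
Proof.
move=> sr; have := cox_word_relator m s r.
rewrite sr cox_word_flatten expgS expg2 -!mulgA => e.
have /mulg1_eq : (g s * (g r * g s) * (g r * (g s * g r)) = 1)%g by rewrite -!mulgA.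
by rewrite !invgM !cox_gen_inv -!mulgA => ->.
Qed.

(** If the last letters r and s differ, they are commuting descents of the common
    final state; both words are then equivalent to one that climbs to the state
    below both descents and continues with r and s. *)
Lemma climb_unique u v :
  climbs base u -> climbs base v -> run base u = run base v -> cw u = cw v.
Proof.
have [k] := ubnP (size u); elim: k => // k IHk in u v *.
case/lastP: u => [|u r] szu cu cv euv.
  by move: (size_climb cv); rewrite -euv rank_base => /size0nil->.
case/lastP: v cv euv => [|v s] cv euv.
  by move: (size_climb cu); rewrite euv rank_base size_rcons.
move: szu; rewrite size_rcons !ltnS => szu.
move: cu cv; rewrite !climbs_rcons => -[cu up_r] [cv up_s].
move: euv; rewrite !run_rcons !cox_word_rcons => euv.
have [rs|nrs] := eqVneq r s.
  by rewrite -rs (IHk u v) //; apply: (@act_inj r); rewrite euv rs.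
set x := act (run base u) r.
have down_r : rank (act x r) < rank x by rewrite actK.
have down_s : rank (act x s) < rank x by rewrite /x euv actK.
have [mrs down_rs] := act_down2 nrs down_r down_s.
have [p cp ep] : exists2 p, climbs base p & run base p = act (run base u) s.
  by apply: climb_down => //; move: down_rs; rewrite actK.
have ep' : run base p = act (run base v) r.
  by rewrite ep -(actK r (run base u)) -/x /x euv actC // actK.
have ex : run base u = act x r by rewrite actK.
have ev : run base v = act x s by rewrite /x euv actK.
have up2 : rank (act x r) = (rank (run base p)).+1.
  by rewrite ep ex; apply: rank_down.
have same : rank (act x s) = rank (act x r).
  by move: (rank_down down_s) (rank_down down_r); lia.
rewrite (IHk u (rcons p s)) ?cox_word_rcons //; last first.
- by rewrite run_rcons ep actK.
- by rewrite climbs_rcons ep actK -ep ex up2; split.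
rewrite (IHk v (rcons p r)) ?cox_word_rcons //; last first.
- by rewrite run_rcons ep' actK.
- by rewrite climbs_rcons ep' actK -ep' ev same up2; split.
- by rewrite (size_climb cv) ev same -ex -(size_climb cu).
by rewrite -!mulgA (cox_genC mrs).
Qed.

(** The words in the generators of the parabolic subgroup whose cosets are the
    states. *)
Definition base_word a := forall s, s \in a -> act base s = base.

Lemma run_base_word a u : base_word a -> run base (a ++ u) = run base u.
Proof.
elim: a => //= s a IHa sa; rewrite sa ?mem_head // IHa // => r ra.
by apply: sa; rewrite inE ra orbT.
Qed.

(** The letter s moves to the front of u: it commutes with the last letter r of u,
    or it braids with r; then u can be taken to end with s r, and s r s = r s r
    leaves a letter r that fixes the state before s r. *)
Lemma climb_fix u s : climbs base u -> act (run base u) s = run base u ->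
  exists2 r, act base r = base & (cw u * g s = g r * cw u)%g.
Proof.
have [k] := ubnP (size u); elim: k => // k IHk in u s *.
case/lastP: u => [|u r] szu cu fix_s.
  by exists s; rewrite // cox_word_nil mul1g mulg1.
move: szu; rewrite size_rcons ltnS => szu.
move: (cu); rewrite climbs_rcons run_rcons in fix_s * => -[cu' up_r].
set x := act (run base u) r in fix_s up_r.
have down_r : rank (act x r) < rank x by rewrite actK.
have [mrs|[mrs down_rs]] := act_down_fix down_r fix_s.
  have [|r' br' er'] := IHk u s szu cu'.
    by rewrite -(actK r (run base u)) -/x actC // fix_s.
  exists r' => //; rewrite cox_word_rcons -mulgA (cox_genC mrs) mulgA er'.
  by rewrite !mulgA.
rewrite actK in down_rs.
have [p cp ep] := climb_down cu' down_rs.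
have cps : climbs base (rcons p s).
  by rewrite climbs_rcons ep actK.
have eu : cw u = cw (rcons p s).
  by apply: climb_unique => //; rewrite run_rcons ep actK.
have [||r' br' er'] := IHk p r _ cp.
- apply: leq_trans szu; rewrite (size_climb cp) (size_climb cu') ep ltnS.
  exact: ltnW.
- (* the braid relation carries the fixed letter s of x to r *)
  rewrite ep; apply: (@act_inj s); apply: (@act_inj r).
  rewrite -(act_braid _ mrs) !actK -/x.
  by rewrite -fix_s actK.
exists r' => //; rewrite cox_word_rcons eu cox_word_rcons -!mulgA.
rewrite (mulgA (g s)) (cox_gen_braid (s := s) (r := r)); last by rewrite cox_order_sym.
by rewrite -!mulgA (mulgA (cw p)) er' -!mulgA.
Qed.

(** The parabolic factorisation, built letter by letter: a letter that climbs or
    descends changes v, and a letter that fixes the state passes to a. *)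
Lemma coset_factor u : exists a v,
  [/\ base_word a, climbs base v, run base v = run base u & cw (a ++ v) = cw u].
Proof.
elim/last_ind: u => [|u s [a [v [ba cv ev eu]]]].
  by exists [::], [::]; split=> //; rewrite /climbs addn0.
rewrite run_rcons cox_word_rcons -eu -ev cox_word_cat.
case: (act_rank (run base v) s) => [fix_s|up_s|down_s].
- have [r br er] := climb_fix cv fix_s; exists (rcons a r), v; split=> //.
    by move=> t; rewrite mem_rcons inE => /predU1P[->|/ba].
  by rewrite cox_word_cat cox_word_rcons -!mulgA er.
- exists a, (rcons v s); rewrite run_rcons; split=> //.
    by apply/climbs_rcons; rewrite up_s.
  by rewrite cox_word_cat cox_word_rcons mulgA.
- have [|p cp ep] := climb_down (s := s) cv; first by rewrite down_s.
  exists a, p; split=> //; rewrite cox_word_cat -mulgA; congr (_ * _)%g.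
  rewrite (@climb_unique v (rcons p s)) //.
  + by rewrite cox_word_rcons cox_genKr.
  + by rewrite climbs_rcons ep actK down_s.
  + by rewrite run_rcons ep actK.
Qed.

Lemma climb_minimal u v : climbs base v -> run base u = run base v -> size v <= size u.
Proof.
move=> /size_climb-> <-; apply: leq_trans (rank_run_le _ _) _.
by rewrite rank_base.
Qed.

Lemma climb_reduced v : climbs base v -> reduced m v.
Proof.
move=> cv; have [u ru uv] := reduced_word (cw v).
apply/eqP; rewrite eqn_leq cox_length_word andbT -uv -ru.
by apply: climb_minimal => //; apply: run_word.
Qed.

(** A letter deleted from a ++ v by the exchange property comes neither from
    the reduced word a, nor from v, as the rest would be a word that reaches
    the same coset in fewer steps. *)
Lemma base_climb_reduced a v :
  base_word a -> reduced m a -> climbs base v -> reduced m (a ++ v).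
Proof.
move=> ba ra cv; elim: a => [|s a IHa] in ba ra *; first exact: climb_reduced.
have ba' : base_word a by move=> r r_a; apply: ba; rewrite inE r_a orbT.
have ra' : reduced m a := reduced_catr (a := [:: s]) ra.
have rav := IHa ba' ra'.
have [lt|nlt] := boolP (len (g s * cw (a ++ v)) < len (cw (a ++ v))); last first.
  by rewrite /reduced /= cox_word_cons (cox_length_gen_up nlt) -rav.
have [[p [r [q [ea spq]]]]|[p [r [q [ev spq]]]]] := exchange_cat (reflection_gen m s) lt.
  move: ra; rewrite /reduced cox_word_cons spq ea /= !size_cat /=.
  by have := cox_length_word m (p ++ q); rewrite size_cat; lia.
have : size v <= size (p ++ q).
  apply: climb_minimal => //; rewrite -(run_base_word (a := a)) //.
  rewrite -(run_base_word (a := s :: a) v) //; apply: run_word.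
  by rewrite -spq /= cox_word_cons.
by rewrite ev !size_cat /= addnS ltnn.
Qed.

(** In the parabolic factorisation of w, the first letter of a nonempty factor in
    the parabolic subgroup would be a left descent. *)
Lemma ex_climb w : (forall s, left_descent s w -> act base s <> base) ->
  exists2 v, climbs base v & cw v = w.
Proof.
have [u <-] := cox_word_surj w; have [a [v [ba cv ev eu]]] := coset_factor u.
have [a' [ra' ea' sub_a']] := reduced_subword m a.
have ba' : base_word a' by move=> s /sub_a'/ba.
have rav := base_climb_reduced ba' ra' cv.
rewrite -eu cox_word_cat -ea' -cox_word_cat.
case: a' {ra' ea' sub_a'} => [|s a'] in ba' rav *; first by exists v.
move=> /(_ s) []; last by apply: ba'; rewrite mem_head.
rewrite /left_descent /= cox_word_cons cox_genK -cox_word_cons -rav.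
by rewrite -(reduced_catr (a := [:: s]) rav).
Qed.

Lemma climb_right_descent v s : climbs base v ->
  rank (act (run base v) s) < rank (run base v) -> right_descent s (cw v).
Proof.
move=> cv down_s; have [p cp ep] := climb_down cv down_s.
have -> : cw v = cw (rcons p s).
  apply: climb_unique => //; rewrite ?run_rcons ?ep ?actK //.
  by rewrite climbs_rcons ep actK.
rewrite /right_descent cox_word_rcons cox_genKr -cox_word_rcons.
rewrite -(climb_reduced cp) -climb_reduced ?size_rcons //.
by rewrite climbs_rcons ep actK.
Qed.

Definition state_le x y := exists2 u, climbs x u & run x u = y.

Lemma state_le_refl x : state_le x x.
Proof. by exists [::]; rewrite // /climbs addn0. Qed.

Lemma state_le_trans y x z : state_le x y -> state_le y z -> state_le x z.
Proof.
move=> [u cu <-] [v cv <-]; exists (u ++ v); last by rewrite run_cat.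
by apply/climbs_cat.
Qed.

Lemma state_le_up x s : rank x < rank (act x s) -> state_le x (act x s).
Proof. by move=> up; exists [:: s] => //; apply/climbs_cons; split=> //; rewrite /climbs addn0. Qed.

Lemma state_le_rank x y : state_le x y -> rank x <= rank y.
Proof. by move=> [u cu <-]; rewrite cu leq_addr. Qed.

Lemma state_le_ind (P : X -> X -> Prop) :
  (forall x, P x x) -> (forall x y z, P x y -> P y z -> P x z) ->
  (forall x s, rank x < rank (act x s) -> P x (act x s)) ->
  forall x y, state_le x y -> P x y.
Proof.
move=> Pxx Ptrans Pstep x y [u cu <-]; elim: u x cu => //= s u IHu x.
by move=> /climbs_cons[up_s cu]; apply: Ptrans (IHu _ cu); apply: Pstep.
Qed.

(** The action of the 0-Hecke monoid. *)
Definition act_up s x := if rank x < rank (act x s) then act x s else x.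

Lemma act_up_le s x : state_le x (act_up s x).
Proof. by rewrite /act_up; case: ifP => [/state_le_up|_] //; apply: state_le_refl. Qed.

Lemma act_le_up s x : state_le (act x s) (act_up s x).
Proof.
rewrite /act_up; case: ifP => [_|]; first exact: state_le_refl.
case: (act_rank x s) => [->|->|e _]; [by move=> _; apply: state_le_refl|by rewrite ltnSn|].
by rewrite -{2}(actK s x); apply: state_le_up; rewrite actK e.
Qed.

Lemma act_up_mono s x y : state_le x y -> state_le (act_up s x) (act_up s y).
Proof.
move: x y; apply: state_le_ind => [x|x y z|x r up_r]; first exact: state_le_refl.
  exact: state_le_trans.
have [<-|nrs] := eqVneq r s.
  by rewrite {1}/act_up up_r; apply: act_up_le.
rewrite {1}/act_up; case: ifP => [up_s|_]; last first.
  exact: state_le_trans (state_le_up up_r) (act_up_le _ _).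
have [mrs up_rs] := act_up2 nrs up_r up_s.
rewrite /act_up up_rs actC //; apply: state_le_up.
by rewrite -actC // (rank_up up_rs) (rank_up up_r) (rank_up up_s).
Qed.

Lemma climbs_run_mono x y u :
  state_le x y -> climbs y u -> state_le (run x u) (run y u).
Proof.
elim: u x y => //= s u IHu x y xy /climbs_cons[up_s cu]; apply: IHu => //.
apply: state_le_trans (act_le_up s x) _.
by have := act_up_mono s xy; rewrite {2}/act_up up_s.
Qed.

(** By exchange the smaller element arises from a word for the larger one by
    deleting a letter. A letter of the parabolic factor has no effect on the
    state; after a deleted climbing letter, the remaining letters start from a
    smaller state and preserve the order by [act_up_mono]. *)
Lemma coset_state_mono w w' : (w <= w')%O -> state_le (coset_state w) (coset_state w').
Proof.
move: w w'; apply: bruhat_ind => [w|x y z|t x rt lt]; first exact: state_le_refl.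
  exact: state_le_trans.
have [u eu] := cox_word_surj (t * x)%g.
have [a [v [ba cv _ ev]]] := coset_factor u.
have ex : (t * cw (a ++ v) = x)%g by rewrite ev eu mulgA reflection_sq ?mul1g.
rewrite -eu -ev in lt *.
move: lt; rewrite -{1}ex => /(exchange_cat rt)[[p [s [q [ea spq]]]]|[p [s [q [e spq]]]]].
  have -> : coset_state x = coset_state (cw (a ++ v)); last exact: state_le_refl.
  rewrite -ex cox_word_cat mulgA spq -!cox_word_cat !coset_state_word.
  rewrite !run_base_word // => r; rewrite mem_cat => rpq.
  by apply: ba; rewrite ea mem_cat inE; case/orP: rpq => ->; rewrite ?orbT.
rewrite -ex spq !coset_state_word !(run_base_word _ ba).
move: cv; rewrite e climbs_cat !run_cat climbs_cons => -[_ [up_s cq]].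
by apply: climbs_run_mono => //; apply: state_le_up.
Qed.

Lemma climb_le u v : climbs base u -> climbs base v ->
  state_le (run base u) (run base v) -> (cw u <= cw v)%O.
Proof.
move=> cu cv [p cp ep].
rewrite (@climb_unique v (u ++ p)) ?run_cat //; last by rewrite climbs_cat.
by apply/bruhat_prefix/climb_reduced; rewrite climbs_cat.
Qed.

End MinusculeAction.

(** * Join-irreducibility from a unique descent *)

Section MinusculeJoinIrreducible.
Variables (S : finType) (m : coxeter_matrix S) (X : minuscule_action m).
Implicit Types (s r : S) (u v a p : seq S) (w x y z : coxeter_group m).

Local Notation cw := (cox_word m).
Local Notation g := (cox_gen m).
Local Notation len := cox_length.
Local Notation base := (base X).

(** The Demazure product with a generator, an upper bound of z and of s z for every
    z <= x. *)
Definition gen_up s x := if len x < len (g s * x) then (g s * x)%g else x.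

Lemma gen_up_le s x y : (x <= y)%O -> (x <= gen_up s y)%O.
Proof.
by rewrite /gen_up; case: ifP => // /bruhat_le_gen sy xy; apply: le_trans sy.
Qed.

Lemma gen_mul_le_up s x y : (x <= y)%O -> ((g s * x)%g <= gen_up s y)%O.
Proof.
move=> xy; rewrite /gen_up; case: ifP => [/bruhat_le_gen sy|/negbT nup].
  have [_ [le|//] _] := bruhat_gen_mul s xy; exact: le_trans sy.
by apply: bruhat_lift => //; rewrite ltn_neqAle cox_length_gen_neq leqNgt.
Qed.

Definition word_up u x := foldr gen_up x u.

Lemma word_up_le u x y : (x <= y)%O -> (x <= word_up u y)%O.
Proof. by move=> xy; elim: u => //= s u IHu; apply: gen_up_le. Qed.

Lemma gen_mul_le_word_up u s x y :
  s \in u -> (x <= y)%O -> ((g s * x)%g <= word_up u y)%O.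
Proof.
move=> + xy; elim: u => //= r u IHu; rewrite inE.
have [->|_ /= /IHu] := eqVneq s r; last exact: gen_up_le.
by move=> _; apply/gen_mul_le_up/word_up_le.
Qed.

Lemma word_mul_le_up u a x y : {subset a <= u} -> (x <= y)%O ->
  ((cw a * x)%g <= iter (size a) (word_up u) y)%O.
Proof.
move=> + xy; elim: a => [|s a IHa] au /=; first by rewrite cox_word_nil mul1g.
rewrite cox_word_cons -mulgA; apply: gen_mul_le_word_up; first exact/au/mem_head.
by apply: IHa => r ra; apply: au; rewrite inE ra orbT.
Qed.

Lemma iter_word_up_le u x j k : j <= k -> (iter j (word_up u) x <= iter k (word_up u) x)%O.
Proof.
move=> /subnK <-; elim: (k - j) => // i IHi.
by rewrite addSn /=; apply: word_up_le.
Qed.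

Lemma coset_state_gen_mul s x :
  act base s = base -> coset_state X (g s * x)%g = coset_state X x.
Proof.
move=> bs; have [u <-] := cox_word_surj x.
by rewrite -cox_word_cons !coset_state_word /= bs.
Qed.

Lemma coset_state_word_up u x :
  base_word X u -> coset_state X (word_up u x) = coset_state X x.
Proof.
elim: u => //= s u IHu bu; rewrite /gen_up.
have IH : coset_state X (word_up u x) = coset_state X x.
  by apply: IHu => r ru; apply: bu; rewrite inE ru orbT.
by case: ifP; rewrite // coset_state_gen_mul //; apply: bu; rewrite mem_head.
Qed.

Lemma coset_state_iter_word_up u x k :
  base_word X u -> coset_state X (iter k (word_up u) x) = coset_state X x.
Proof. by move=> bu; elim: k => //= k <-; apply: coset_state_word_up. Qed.

(** Let y be the state of w = cw v, and let w be the join of U without being in U.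
    Every u < w has a state strictly below y: its state is at most y by
    [coset_state_mono], and equality would make u at least as long as w. As r is
    the only way down from y, the state of u is even at most act y r. Multiplying
    the representative of act y r repeatedly by all letters that fix the base, in
    the Demazure sense, therefore gives an upper bound z of U in the coset act y r.
    Then w <= z would give y <= act y r. *)
Lemma climb_join_irreducible v r : climbs base v ->
    rank (act (run base v) r) < rank (run base v) ->
    (forall s, rank (act (run base v) s) < rank (run base v) -> s = r) ->
  join_irreducible (cw v).
Proof.
move=> cv down_r uniq_r [U [ubU lbU] nU].
set y := run base v in down_r uniq_r.
have [p cp ep] := climb_down cv down_r.
pose J := [seq s <- enum S | `[< act base s = base >]].
have bJ : base_word X J by move=> s; rewrite mem_filter => /andP[/asboolP].
pose z := iter (size v) (word_up J) (cw p).
have zp : coset_state X z = act y r.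
  by rewrite coset_state_iter_word_up // coset_state_word.
suff ubz : ubound U z.
  have := coset_state_mono X (lbU z ubz); rewrite zp coset_state_word -/y.
  by move=> /state_le_rank; rewrite leqNgt down_r.
move=> x Ux; have xv := ubU x Ux.
have [u ux] := cox_word_surj x; have [a [q [ba cq eq eu]]] := coset_factor X u.
have {u ux eq} eu : cw (a ++ q) = x by rewrite eu.
have lt_x : len x < size v.
  rewrite (climb_reduced cv); case: (bruhat_length xv) => // e.
  by case: nU; rewrite -e.
have [b [rb eb sub_b]] := reduced_subword m a.
have bb : base_word X b by move=> s /sub_b/ba.
have rbq := base_climb_reduced bb rb cq.
have ex : x = (cw b * cw q)%g by rewrite -eu eb cox_word_cat.
have szx : len x = size b + size q by rewrite ex -cox_word_cat -rbq size_cat.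
have le_qv : state_le (run base q) y.
  have := coset_state_mono X xv.
  by rewrite -eu !coset_state_word run_base_word.
have le_qp : state_le (run base q) (run base p).
  case: le_qv => c; case/lastP: c => [_|c s].
    rewrite /= => e; exfalso; move: (size_climb cv) (size_climb cq).
    rewrite -/y -e => <- eqv; move: lt_x.
    by rewrite szx eqv ltnNge leq_addl.
  rewrite climbs_rcons run_rcons => -[cc up_s] ec.
  have es : s = r by apply: uniq_r; rewrite -ec actK.
  by exists c => //; rewrite ep -/y -ec es actK.
rewrite ex; apply: (@le_trans _ _ (iter (size b) (word_up J) (cw p))).
  apply: word_mul_le_up; last exact: (climb_le (X := X)).
  by move=> s sb; rewrite mem_filter mem_enum andbT; apply/asboolP/bb.
by apply/iter_word_up_le/(leq_trans _ (ltnW lt_x)); rewrite szx leq_addr.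
Qed.

End MinusculeJoinIrreducible.

(** * Sign patterns and the action of type D *)

Section SignedSwaps.
Implicit Types (f : nat -> bool) (b d : bool) (p q x : nat).

(** Sign patterns are functions on nat with true for a minus sign; exchanging two
    coordinates with b = true also negates both. *)
Definition signed_swap b p f x : bool :=
  if x == p then b (+) f p.+1 else if x == p.+1 then b (+) f p else f x.

Lemma signed_swap_l b p f : signed_swap b p f p = b (+) f p.+1.
Proof. by rewrite /signed_swap eqxx. Qed.

Lemma signed_swap_r b p f : signed_swap b p f p.+1 = b (+) f p.
Proof. by rewrite /signed_swap eqxx; case: eqP => //; lia. Qed.

Lemma signed_swap_out b p f x : x != p -> x != p.+1 -> signed_swap b p f x = f x.
Proof. by rewrite /signed_swap => /negbTE-> /negbTE->. Qed.

Lemma signed_swapK b p f : signed_swap b p (signed_swap b p f) = f.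
Proof.
apply/funext => x.
have [->|xp] := eqVneq x p; first by rewrite signed_swap_l signed_swap_r addKb.
have [->|xp1] := eqVneq x p.+1; first by rewrite signed_swap_r signed_swap_l addKb.
by rewrite !signed_swap_out.
Qed.

Lemma signed_swap_fix b p f : signed_swap b p f = f <-> f p (+) f p.+1 = b.
Proof.
split=> [e|<-]; first by rewrite -{1}e signed_swap_l addbK.
apply/funext => x.
have [->|xp] := eqVneq x p; first by rewrite signed_swap_l addbK.
have [->|xp1] := eqVneq x p.+1; first by rewrite signed_swap_r addbC addKb.
by rewrite signed_swap_out.
Qed.

Lemma signed_swapC b d p q f : p = q \/ p.+1 < q \/ q.+1 < p ->
  signed_swap b p (signed_swap d q f) = signed_swap d q (signed_swap b p f).
Proof.
move=> pq; apply/funext => x; rewrite /signed_swap.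
repeat (case: eqP => ?); subst; try lia; rewrite ?addbA ?(addbC b) //.
Qed.

Lemma signed_swap_braid b d p f :
  signed_swap b p (signed_swap d p.+1 (signed_swap b p f)) =
  signed_swap d p.+1 (signed_swap b p (signed_swap d p.+1 f)).
Proof.
apply/funext => x; rewrite /signed_swap.
by repeat (case: eqP => ?); subst; try lia; rewrite // ?addbA ?(addbC b).
Qed.

Lemma sum_signed_swap (w : nat -> nat) N b p f : p.+1 < N ->
  \sum_(i < N) w i * signed_swap b p f i + (w p * f p + w p.+1 * f p.+1) =
  \sum_(i < N) w i * f i + (w p * (b (+) f p.+1) + w p.+1 * (b (+) f p)).
Proof.
move=> lt1; have lt0 : p < N by exact: ltnW.
pose i0 := Ordinal lt0; pose i1 := Ordinal lt1.
have n10 : i1 != i0 by rewrite -val_eqE /=; lia.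
rewrite !(bigD1 (P := predT) i0) //= !(bigD1 (P := fun i => i != i0) i1) //=.
rewrite signed_swap_l signed_swap_r.
rewrite (eq_bigr (fun i : 'I_N => w i * f i)); first by lia.
by move=> i /andP[ni0 ni1]; rewrite signed_swap_out.
Qed.

Lemma sum_interval (w : nat -> nat) N j k : j + k < N ->
  \sum_(i < N) w i * (j < i <= j + k) = \sum_(l < k) w (j + l).+1.
Proof.
elim: k => [|k IHk] jkN.
  by rewrite big_ord0 big1 // => i _; rewrite addn0; case: ltnP; rewrite muln0.
rewrite big_ord_recr /= -IHk; last by lia.
have lt : (j + k).+1 < N by lia.
pose i0 := Ordinal lt.
rewrite !(bigD1 (P := predT) i0) //=.
have -> : j < (j + k).+1 <= j + k.+1 by lia.
have -> : (j < (j + k).+1 <= j + k) = false by lia.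
rewrite muln0 add0n muln1 addnC; congr (_ + _); apply: eq_bigr => i.
rewrite -val_eqE /= => ni; congr (_ * nat_of_bool _); lia.
Qed.

End SignedSwaps.

Section TypeD.
Variables (n : nat) (c : bool).
Implicit Types (f : nat -> bool) (s r : nodeD n).

Definition node_pos s : nat := if s is inr i then i.+1 else 0.
Definition node_sign s : bool := if s is inl d then d == c else false.

(** The Weyl group of type D acts on the coordinates 0, ..., n + 1 by permutations
    and even sign changes, with [inl c] as the letter that exchanges and negates
    the first two coordinates, and all other letters as adjacent transpositions.
    The orbit of the pattern without minus signs consists of the cosets of the
    parabolic subgroup generated by the letters other than [inl c]. *)
Definition actD f s := signed_swap (node_sign s) (node_pos s) f.

(** Each climbing letter moves a minus sign from p to p + 1, or creates minus signs
    at 0 and 1. *)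
Definition weight_rank f := \sum_(i < n.+2) i * f i.

Lemma node_pos_lt s : (node_pos s).+1 < n.+2.
Proof. by case: s => [d|i] //=; rewrite !ltnS. Qed.

Lemma node_sign_pos s : node_sign s -> node_pos s = 0.
Proof. by case: s. Qed.

Lemma node_inj s r : node_pos s = node_pos r -> node_sign s = node_sign r -> s = r.
Proof.
case: s r => [d|i] [d'|i'] //=; last by move=> [e] _; congr inr; apply: val_inj.
by move=> _; case: d d' c => [] [] [].
Qed.

Lemma coxD_edgeE s r :
  coxD_edge s r = ((node_pos s).+1 == node_pos r) || ((node_pos r).+1 == node_pos s).
Proof. by case: s r => [d|i] [d'|i'] //=; rewrite ?orbF eqSS // eq_sym. Qed.

Lemma actD_relator s r f :
  foldl actD f (flatten (nseq (coxD n s r) [:: s; r])) = f.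
Proof.
rewrite /= /coxD_order coxD_edgeE /actD.
have [<-|nsr] := eqVneq s r; first by rewrite /= signed_swapK.
case: ifP => /=.
  case/orP => /eqP e; [rewrite -e -signed_swap_braid|rewrite -e signed_swap_braid].
    by rewrite !signed_swapK.
  by rewrite !signed_swapK.
move=> /norP[/eqP n1 /eqP n2].
by rewrite (@signed_swapC _ _ (node_pos s)) ?signed_swapK //; lia.
Qed.

Lemma actD_weight s f :
  weight_rank (actD f s) + (node_pos s * f (node_pos s) + (node_pos s).+1 * f (node_pos s).+1) =
  weight_rank f + (node_pos s * (node_sign s (+) f (node_pos s).+1) +
                   (node_pos s).+1 * (node_sign s (+) f (node_pos s))).
Proof. exact: (sum_signed_swap (fun i => i)) (node_pos_lt s). Qed.

Lemma actD_down s f :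
  (weight_rank (actD f s) < weight_rank f) = f (node_pos s).+1 && (f (node_pos s) == node_sign s).
Proof.
have := actD_weight s f.
by case: (f _) (f _) (node_sign s) => [] [] [] /=; lia.
Qed.

Lemma actD_up s f :
  (weight_rank f < weight_rank (actD f s)) =
  ~~ f (node_pos s).+1 && (f (node_pos s) != node_sign s).
Proof.
have := actD_weight s f.
by case: (f _) (f _) (node_sign s) => [] [] [] /=; lia.
Qed.

Lemma actD_fix s f : actD f s = f <-> f (node_pos s) (+) f (node_pos s).+1 = node_sign s.
Proof. exact: signed_swap_fix. Qed.

Lemma actD_rank f s :
  [\/ actD f s = f, weight_rank (actD f s) = (weight_rank f).+1
    | weight_rank f = (weight_rank (actD f s)).+1].
Proof.
have : node_sign s * node_pos s = 0 by case: (s) => [d|i]; rewrite ?muln0 ?mul0n.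
have := actD_weight s f; have := actD_fix s f.
case: (f _) (f _) (node_sign s) => [] [] [] /= fx e p0;
  first [by constructor 1; apply/fx | by constructor 2; lia | by constructor 3; lia].
Qed.

Lemma actD_down2 f s r : s != r ->
    weight_rank (actD f s) < weight_rank f -> weight_rank (actD f r) < weight_rank f ->
  coxD n s r = 2 /\ weight_rank (actD (actD f s) r) < weight_rank (actD f s).
Proof.
rewrite !actD_down => nsr /andP[f1s /eqP f0s] /andP[f1r /eqP f0r].
have sr1 : (node_pos s).+1 != node_pos r.
  apply/eqP => e; move: f0r; rewrite -e f1s => /esym/node_sign_pos; lia.
have sr2 : (node_pos r).+1 != node_pos s.
  apply/eqP => e; move: f0s; rewrite -e f1r => /esym/node_sign_pos; lia.
have sr : node_pos s != node_pos r.
  apply: contra nsr => /eqP e; apply/eqP/node_inj => //.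
  by rewrite -f0s -f0r e.
rewrite /= /coxD_order coxD_edgeE (negbTE nsr) (negbTE sr1) (negbTE sr2); split=> //.
by rewrite /actD !signed_swap_out ?f1r ?f0r ?eqxx //; lia.
Qed.

Lemma actD_up2 f s r : s != r ->
    weight_rank f < weight_rank (actD f s) -> weight_rank f < weight_rank (actD f r) ->
  coxD n s r = 2 /\ weight_rank (actD f s) < weight_rank (actD (actD f s) r).
Proof.
rewrite !actD_up => nsr /andP[f1s f0s] /andP[f1r f0r].
have sr1 : (node_pos s).+1 != node_pos r.
  apply/eqP => e; move: f0r; rewrite -e (negbTE f1s); case E: (node_sign r) => // _.
  by have := node_sign_pos E; lia.
have sr2 : (node_pos r).+1 != node_pos s.
  apply/eqP => e; move: f0s; rewrite -e (negbTE f1r); case E: (node_sign s) => // _.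
  by have := node_sign_pos E; lia.
have sr : node_pos s != node_pos r.
  apply: contra nsr => /eqP e; apply/eqP/node_inj => //.
  by move: f0s f0r; rewrite e; case: (f _) (node_sign s) (node_sign r) => [] [] [].
rewrite /= /coxD_order coxD_edgeE (negbTE nsr) (negbTE sr1) (negbTE sr2); split=> //.
by rewrite /actD !signed_swap_out ?f1r ?f0r //; lia.
Qed.

Lemma actD_down_fix f s r : weight_rank (actD f s) < weight_rank f -> actD f r = f ->
  coxD n s r = 2 \/
  coxD n s r = 3 /\ weight_rank (actD (actD f s) r) < weight_rank (actD f s).
Proof.
rewrite actD_fix actD_down => /andP[f1 /eqP f0] fr.
have nsr : s != r.
  by apply/eqP => e; move: fr; rewrite -e f0 f1 addbT; case: node_sign.
rewrite /= /coxD_order coxD_edgeE (negbTE nsr).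
case: ifP => [adj|_]; [right; split=> //|by left].
rewrite actD_down; case/orP: adj => /eqP e.
  have nr : node_sign r = false.
    by apply/negP => /node_sign_pos; lia.
  have f2 : f (node_pos r).+1.
    by move: fr; rewrite nr -e f1; case: (f _).
  rewrite /actD {1}/signed_swap -e signed_swap_r f0 addbb nr eqxx andbT e.
  by rewrite f2; do 2?case: eqP; lia.
have ns : node_sign s = false.
  by apply/negP => /node_sign_pos; lia.
rewrite /actD e signed_swap_l ns f1 /= signed_swap_out; try lia.
by move: fr; rewrite e f0 ns addbF => ->.
Qed.

Definition minuscule_D : minuscule_action (coxD n).
Proof.
exists (nat -> bool) actD weight_rank (fun=> false).
- exact: actD_relator.
- by rewrite /weight_rank big1 // => i _; rewrite muln0.
- exact: actD_rank.
- exact: actD_down2.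
- exact: actD_up2.
- exact: actD_down_fix.
Defined.

Lemma base_fix s : act (base minuscule_D) s = base minuscule_D <-> s <> inl c.
Proof.
rewrite [_ = _]actD_fix /=; case: s => [d|i]; last by split.
rewrite /node_sign; have [->|ndc] := eqVneq d c; first by split=> [|[]].
split=> //.
by move=> _ [e]; rewrite e eqxx in ndc.
Qed.

End TypeD.

(** The images of the generators in the group of signed permutations differ. *)
Lemma coxD_gen_inj n : injective (cox_gen (coxD n)).
Proof.
move=> s r e.
have act_sr f : actD true f s = actD true f r.
  exact: (run_word (X := minuscule_D n true) f (u := [:: s]) (v := [:: r]) e).
have lt_sep (s' r' : nodeD n) :
    node_pos s' < node_pos r' -> exists f, actD true f s' <> actD true f r'.
  move=> lt; exists (fun x => x == (node_pos r').+1) => /(congr1 (@^~ (node_pos r').+1)).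
  rewrite {2}/actD signed_swap_r {1}/actD signed_swap_out ?eqxx; try lia.
  case E: (node_sign true r'); first by have := node_sign_pos E; lia.
  by rewrite /= ltn_eqF.
have epos : node_pos s = node_pos r.
  case: (ltngtP (node_pos s) (node_pos r)) => // /lt_sep[f] //.
  by rewrite act_sr.
apply: (@node_inj n true) => //.
have := congr1 (@^~ (node_pos s)) (act_sr (fun=> false)).
by rewrite {2}/actD -epos /actD !signed_swap_l !addbF.
Qed.

(** * Reachable sign patterns with a unique descent *)

Section ReachableStates.
Variables (n : nat) (c : bool).
Implicit Types (f : nat -> bool) (s r : nodeD n).

Local Notation XD := (minuscule_D n c).

(** The states reachable from the pattern without minus signs are among the
    patterns supported on 0, ..., n + 1 with an even number of minus signs. *)
Definition even_state f :=
  (forall x, n.+1 < x -> f x = false) /\ odd (\sum_(x < n.+2) f x) = false.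

Lemma even_state_act f s : even_state f -> even_state (actD c f s).
Proof.
have lt := node_pos_lt s.
move=> [fout feven]; split=> [x nx|].
  by rewrite /actD signed_swap_out ?fout //; lia.
have := @sum_signed_swap (fun=> 1) n.+2 (node_sign c s) (node_pos s) f lt.
rewrite (eq_bigr (fun x : 'I_n.+2 => nat_of_bool (actD c f s x))); last first.
  by move=> x _; rewrite mul1n.
rewrite [in RHS](eq_bigr (fun x : 'I_n.+2 => nat_of_bool (f x))); last first.
  by move=> x _; rewrite mul1n.
move=> /(congr1 odd); rewrite oddD [in RHS]oddD feven !mul1n !oddD !oddb.
by case: (odd _) (f _) (f _) (node_sign c s) => [] [] [] [].
Qed.

Lemma even_state_run u : even_state (run (base XD) u).
Proof.
elim/last_ind: u => [|u s IHu]; last by rewrite run_rcons; apply: even_state_act.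
by split=> //; rewrite big1.
Qed.

(** Ones at the positions j + 1, ..., j + k, and at position 0 the value that makes
    the number of ones even. *)
Definition interval_state k j x : bool :=
  if x == 0 then odd k else (j < x <= j + k).

Lemma even_interval f k j : even_state f -> j + k <= n.+1 ->
  (forall x, 0 < x -> f x = (j < x <= j + k)) -> f = interval_state k j.
Proof.
move=> [fout feven] jk fI; apply/funext => -[|x]; last by rewrite fI.
rewrite /interval_state /=; move: feven.
have /= := @sum_interval (fun=> 1) n.+2 j k; rewrite ltnS => /(_ jk).
rewrite sum1_card card_ord big_ord_recl /= => sum_k.
rewrite big_ord_recl (eq_bigr (fun i : 'I_n.+1 => 1 * (j < lift ord0 i <= j + k))).
  by move: sum_k; rewrite add0n => ->; rewrite oddD oddb; case: (f 0) (odd k) => [] [].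
by move=> i _; rewrite mul1n -fI.
Qed.

(** The block ends before the first 0 above p; a later 1 would lead to a 1 directly
    above a 0. *)
Lemma single_block f p : (forall x, n.+1 < x -> f x = false) ->
    f p.+1 -> (forall q, p < q <= n -> f q.+1 -> f q) ->
  exists k, [/\ 0 < k, p + k <= n.+1 & forall x, p < x -> f x = (x <= p + k)].
Proof.
move=> fout fp noup.
have exz : exists z, (p < z) && ~~ f z.
  by exists (maxn p.+1 n.+2); rewrite fout; lia.
case: (ex_minnP exz) => z /andP[pz /negbTE fz] minz.
have onz x : p < x < z -> f x.
  by move=> /andP[px xz]; apply: contraT => nfx; have := minz x; rewrite px nfx; lia.
have z1 : z != p.+1 by apply: contraTneq fp => <-; rewrite fz.
have pn : p <= n by rewrite leqNgt; apply: contraTN fp => np; rewrite fout.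
have zn : z <= n.+2.
  rewrite leqNgt; apply/negP => nz.
  by have /onz : p < n.+2 < z by [lia]; rewrite fout.
have offz x : z <= x -> f x = false.
  elim: x => [|x IHx]; first by lia.
  rewrite leq_eqVlt => /predU1P[<- //|]; rewrite ltnS => zx.
  have [nx|xn] := ltnP n x; first by apply: fout.
  apply/negP => fx1; have := noup x; rewrite IHx // fx1; lia.
exists (z - p.+1); split; try lia.
move=> x px; have -> : (x <= p + (z - p.+1)) = (x < z) by lia.
have [xz|zx] := ltnP x z; first by rewrite onz ?px.
exact: offz.
Qed.

Lemma interval_state_down k j s : 0 < k -> j + k <= n.+1 ->
  (weight_rank n (actD c (interval_state k j) s) < weight_rank n (interval_state k j)) =
  match s with inl d => (j == 0) && (odd k == (d == c)) | inr i => j == i.+1 end.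
Proof.
move=> k0 jk; rewrite actD_down; case: s => [d|i] /=.
  rewrite /interval_state /=; congr (_ && _); lia.
rewrite /interval_state /= eqbF_neg; lia.
Qed.

(** Every occurrence of 0, 1 at consecutive positions from 1 on is a descent, and so
    is a one at position 1, by a letter 0^+ or 0^- that depends on position 0. With
    one descent only, the ones from position 1 on form one block. *)
Lemma unique_down_interval f r : even_state f ->
    weight_rank n (actD c f r) < weight_rank n f ->
    (forall s, weight_rank n (actD c f s) < weight_rank n f -> s = r) ->
  exists k j, [/\ 0 < k, j + k <= n.+1 & f = interval_state k j].
Proof.
move=> ef; have [fout _] := ef; rewrite actD_down => /andP[f1 /eqP f0] uniq_r.
have noup q : 0 < q <= n -> q != node_pos r -> f q.+1 -> f q.
  case: q => // q qn nqr fq2; apply: contraNT nqr => nq1.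
  have <- // : inr (Ordinal qn) = r.
  by apply: uniq_r; rewrite actD_down /= fq2 (negbTE nq1).
have [k [k0 pk fk]] : exists k, [/\ 0 < k, node_pos r + k <= n.+1 &
    forall x, node_pos r < x -> f x = (x <= node_pos r + k)].
  apply: single_block => // q /andP[rq qn]; apply: noup; last by rewrite gtn_eqF.
  by rewrite qn (leq_trans _ rq).
exists k, (node_pos r); split=> //; apply: even_interval => // x x0.
have [rx|xr] := ltnP (node_pos r) x; first exact: fk.
elim: x x0 xr => // x IHx _ xr.
case: x IHx xr => [|x] IHx xr.
  (* a one at position 1 allows one of the letters 0^+ and 0^- *)
  apply/negP => fx1; pose d := if f 0 then c else ~~ c.
  have er : inl d = r.
    apply: uniq_r; rewrite actD_down /= fx1 /d.
    by case: (f 0) c => [] [].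
  by rewrite -er in xr.
apply/negP => fx2; have xn : 0 < x.+1 <= n by have := node_pos_lt r; lia.
have nxr : x.+1 != node_pos r by rewrite ltn_eqF.
by have := noup _ xn nxr fx2; rewrite IHx ?(ltnW xr).
Qed.

End ReachableStates.

(** * Type B and the alternation of signs *)

Section TypeB.
Variable n : nat.
Implicit Types (f : nat -> bool) (a : nat).

Definition flip1 f x : bool := (x == 1) (+) f x.

(** Type B acts on the coordinates 1, ..., n + 1 by all signed permutations, with
    the letter 0 as the sign change at 1. Forgetting the coordinate 0, which
    parity determines, identifies the two quotients. *)
Definition actB f a : nat -> bool :=
  if a == 0 then flip1 f else signed_swap false a f.

Lemma flip1K f : flip1 (flip1 f) = f.
Proof. by apply/funext => x; rewrite /flip1 addKb. Qed.

Lemma actBK f a : actB (actB f a) a = f.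
Proof. by rewrite /actB; case: eqP => _; rewrite ?flip1K ?signed_swapK. Qed.

Lemma flip1_swapC a f : 1 < a -> flip1 (signed_swap false a f) = signed_swap false a (flip1 f).
Proof.
move=> a1; apply/funext => x; rewrite /flip1 /signed_swap.
by repeat (case: eqP => ?); subst; try lia.
Qed.

Lemma flip1_swap_braid f :
  flip1 (signed_swap false 1 (flip1 (signed_swap false 1 f))) =
  signed_swap false 1 (flip1 (signed_swap false 1 (flip1 f))).
Proof.
apply/funext => x; rewrite /flip1 /signed_swap.
by repeat (case: eqP => ?); subst; try lia.
Qed.

Definition runB f (u : seq 'I_n.+1) := foldl actB f [seq val i | i <- u].

Lemma runB_cat f u v : runB f (u ++ v) = runB (runB f u) v.
Proof. by rewrite /runB map_cat foldl_cat. Qed.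

Lemma runB_relator f (a b : 'I_n.+1) : runB f (flatten (nseq (coxB n a b) [:: a; b])) = f.
Proof.
rewrite /= /coxB_order /runB.
have [<-|nab] := eqVneq a b; first by rewrite /= actBK.
have nab' : a != b :> nat by [].
have v0 (i : 'I_n.+1) : (i == ord0) = (i == 0 :> nat) by [].
rewrite !v0; case: ifP => [adj|/norP[n1 n2]]; last first.
  rewrite /= /actB; case: eqP => a0; case: eqP => b0.
  - by case/eqP: nab'; rewrite a0 b0.
  - rewrite flip1_swapC ?flip1K ?signed_swapK //; lia.
  - rewrite -flip1_swapC ?signed_swapK ?flip1K //; lia.
  - rewrite (@signed_swapC _ _ a b) ?signed_swapK //; lia.
case: eqP => a0 /=.
  have b1 : b = 1 :> nat by lia.
  by rewrite a0 b1 /actB /= -flip1_swap_braid !(flip1K, signed_swapK).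
case: eqP => b0 /=.
  have a1 : a = 1 :> nat by lia.
  by rewrite b0 a1 /actB /= flip1_swap_braid !(flip1K, signed_swapK).
rewrite /actB; have [/negbTE-> /negbTE->] : a != 0 :> nat /\ b != 0 :> nat by lia.
case/orP: adj => /eqP <-; first by rewrite -signed_swap_braid !signed_swapK.
by rewrite signed_swap_braid !signed_swapK.
Qed.

Lemma runB_equiv f u v : cox_equiv (coxB n) u v -> runB f u = runB f v.
Proof.
move=> uv; elim: uv f => [s r p q f|//|p q _ IH f|p q z _ IHpq _ IHqz f].
- by rewrite !runB_cat [runB (runB f p) _]runB_relator.
- by rewrite IH.
- by rewrite IHpq.
Qed.

Lemma weight_rank_flip1 f :
  weight_rank n (flip1 f) + f 1 = weight_rank n f + ~~ f 1.
Proof.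
have lt : 1 < n.+2 by [].
rewrite /weight_rank !(bigD1 (P := predT) (Ordinal lt)) //= !mul1n addnAC [RHS]addnAC.
congr (_ + _); first by rewrite addnC.
apply: eq_bigr => i; rewrite -val_eqE /= => ni.
by rewrite /flip1 (negbTE ni).
Qed.

Lemma weight_rank_actB f (a : 'I_n.+1) :
  weight_rank n (actB f a) <= (weight_rank n f).+1.
Proof.
rewrite /actB; case: eqP => a0.
  by have := weight_rank_flip1 f; case: (f 1) => /=; lia.
have lt : a.+1 < n.+2 by rewrite ltnS ltn_ord.
have := sum_signed_swap (fun i => i) false f lt.
rewrite /weight_rank; case: (f _) (f _) => [] [] /=; lia.
Qed.

Lemma actB_up f (a : 'I_n.+1) :
  weight_rank n (actB f a) = (weight_rank n f).+1 ->
  ~~ f a.+1 && ((a == 0 :> nat) || f a).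
Proof.
rewrite /actB; case: eqP => a0.
  by rewrite a0; have := weight_rank_flip1 f; case: (f 1) => //=; lia.
have lt : a.+1 < n.+2 by rewrite ltnS ltn_ord.
have := sum_signed_swap (fun i => i) false f lt.
rewrite /weight_rank; case: (f _) (f _) => [] [] //=; lia.
Qed.

Lemma weight_rank_runB f u : weight_rank n (runB f u) <= weight_rank n f + size u.
Proof.
elim: u f => [|a u IHu] f /=; first by rewrite addn0.
by apply: leq_trans (IHu _) _; rewrite addnS -addSn leq_add2r weight_rank_actB.
Qed.

(** Position 0 holds the parity of the number of ones elsewhere. Each letter 0
    that climbs in type B adds a one at position 1, so the sign of the next
    letter 0^+ or 0^- that can climb alternates. *)
Lemma alternate_climbs c d f (F : minuscule_D n c) u :
    F 0 = (d != c) -> (forall x, 0 < x -> F x = f x) ->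
    weight_rank n (runB f u) = weight_rank n f + size u ->
  climbs F (alternate d u) /\ forall x, 0 < x -> run F (alternate d u) x = runB f u x.
Proof.
elim: u d f F => [|a u IHu] d f F F0 Ff /= rk; first by rewrite /climbs addn0.
have up_a : weight_rank n (actB f a) = (weight_rank n f).+1.
  apply/eqP; rewrite eqn_leq weight_rank_actB -(leq_add2r (size u)) addSnnS -rk.
  exact: weight_rank_runB.
have rk_u : weight_rank n (runB (actB f a) u) = weight_rank n (actB f a) + size u.
  by rewrite rk up_a addSnnS.
have {up_a} := actB_up up_a.
case: (unliftP ord0 a) rk_u {rk} => [i ->|->] /= rk_u /andP[fa1 fa].
  have up_i : rank F < rank (act F (inr i)).
    by rewrite [_ < _]actD_up /= !Ff // fa1 eqbF_neg negbK.
  have [||] := IHu d (actB f i.+1) (act F (inr i)) _ _ rk_u.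
  - by rewrite /= /actD signed_swap_out.
  - by move=> x x0; rewrite /= /actD /actB /= /signed_swap !Ff.
  - by move=> cu agree; split=> //; apply/climbs_cons.
have up_d : rank F < rank (act F (inl d)).
  by rewrite [_ < _]actD_up /= F0 Ff // fa1; case: (d == c).
have [||] := IHu (~~ d) (actB f 0) (act F (inl d)) _ _ rk_u.
- rewrite /= /actD signed_swap_l /= Ff // (negbTE fa1) addbF; by case: (d) (c) => [] [].
- case=> [//|[|x]] _; rewrite /= /actD.
    by rewrite signed_swap_r /actB /flip1 /= F0 (negbTE fa1); case: (d == c).
  by rewrite signed_swap_out // /actB /flip1 /= Ff.
- by move=> cu agree; split=> //; apply/climbs_cons.
Qed.

End TypeB.

(** * The elements d_k^{0j} *)

Section BWords.
Implicit Types (f : nat -> bool) (a j k l : nat) (w : seq nat).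

Definition block k j x : bool := j < x <= j + k.

(** The descending word from a + l - 1 to a is the cycle that carries the entry at
    a + l down to a; [run_up] is its inverse. *)
Lemma run_down a l f : 0 < a -> foldl actB f (rev (iota a l)) =
  fun x => if x == a then f (a + l) else if a < x <= a + l then f x.-1 else f x.
Proof.
move=> a0; elim: l f => [|l IHl] f.
  by apply/funext => x /=; rewrite addn0; case: eqP => [->//|_]; case: ltnP => // ax; rewrite leqNgt ax.
rewrite -addn1 iotaD rev_cat foldl_cat /= IHl.
have al0 : a + l == 0 = false by lia.
apply/funext => x; rewrite /actB al0 /signed_swap /= addn1 addnS.
have [_|xa] := eqVneq x a; first by rewrite eqxx.
have [x_in|x_out] := boolP (a < x <= a + l).
  have -> : (x.-1 == a + l) = false by lia.
  have -> : (x.-1 == (a + l).+1) = false by lia.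
  by have -> : a < x <= (a + l).+1 by lia.
have -> : (x == a + l) = false by lia.
case: eqP => [->|nx]; first by have -> : a < (a + l).+1 <= (a + l).+1 by lia.
by have -> : (a < x <= (a + l).+1) = false by lia.
Qed.

Lemma run_up a l f : 0 < a -> foldl actB f (iota a l) =
  fun x => if x == a + l then f a else if a <= x < a + l then f x.+1 else f x.
Proof.
elim: l a f => [|l IHl] a f a0.
  by apply/funext => x /=; rewrite addn0; case: eqP => [->//|_]; case: leqP => // ax; rewrite ltnNge ax.
rewrite /= IHl //; have an0 : a == 0 = false by lia.
apply/funext => x; rewrite /actB an0 /signed_swap /= addnS addSn.
case: eqP => [_|nx].
  by rewrite eqxx; have -> : (a.+1 == a) = false by lia.
have [->|xa] := eqVneq x a.
  have -> : (a < a < (a + l).+1) = false by lia.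
  by have -> : a <= a < (a + l).+1 by lia.
have -> : (a <= x < (a + l).+1) = (a < x < (a + l).+1) by lia.
case: ifP => [x_in|x_out].
  have -> : (x.+1 == a) = false by lia.
  by have -> : (x.+1 == a.+1) = false by lia.
by case: eqP => // xa1; lia.
Qed.

Lemma run_block_shift k j : foldl actB (block k j) (rev (iota j.+1 k)) = block k j.+1.
Proof.
rewrite run_down //; apply/funext => x; rewrite /block.
case: eqP => [->|nx]; first by lia.
case: ifP; lia.
Qed.

Lemma flip1_block k j : 0 < j -> flip1 (block k j) = fun x => (x == 1) || block k j x.
Proof. by move=> j0; apply/funext => x; rewrite /flip1 /block; case: eqP => //; lia. Qed.

Lemma path_word_down a b : b <= a -> path_word a b = rev (iota b (a - b).+1).
Proof.
rewrite /path_word leq_eqVlt => /predU1P[->|ba]; first by rewrite leqnn subnn.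
by rewrite leqNgt ba.
Qed.

Lemma b_word0S k : b_word k.+1 0 = b_word k 0 ++ rev (iota 0 k.+1).
Proof.
rewrite /b_word -{1}addn1 iotaD map_cat flatten_cat /= !cats0.
by rewrite path_word_down // subn0.
Qed.

Lemma b_wordS k j : 0 < k -> b_word k j.+1 = b_word k j ++ rev (iota j.+1 k).
Proof.
move=> k0; rewrite /b_word -(addn1 j) iotaD map_cat flatten_cat /= cats0 add0n catA addn1.
rewrite path_word_down; last by lia.
by have -> : (k + j - j.+1).+1 = k by lia.
Qed.

(** The factor s_{i0} moves the block up by one and fills position 1; the factor
    s_{k+i,i+1} moves the block of length k up by one. *)
Lemma run_b_word k j : 0 < k -> foldl actB (fun=> false) (b_word k j) = block k j.
Proof.
move=> k0; elim: j => [|j IHj]; last by rewrite b_wordS // foldl_cat IHj run_block_shift.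
elim: k {k0} => [|k IHk].
  by rewrite /b_word /=; apply/funext => x; rewrite /block; lia.
rewrite b_word0S foldl_cat IHk /= rev_cons foldl_rcons run_block_shift.
rewrite /actB /= flip1_block //; apply/funext => x; rewrite /block; lia.
Qed.

Lemma size_b_word k j : 0 < k -> size (b_word k j) = \sum_(l < k) (j + l).+1.
Proof.
move=> k0; elim: j => [|j IHj].
  elim: k {k0} => [|k IHk]; first by rewrite big_ord0.
  by rewrite b_word0S size_cat IHk size_rev size_iota big_ord_recr.
rewrite b_wordS // size_cat IHj size_rev size_iota.
rewrite -[X in _ + X]card_ord -sum1_card -big_split /=.
by apply: eq_bigr => l _; rewrite addn1.
Qed.

Lemma b_word_bound n k j a : 0 < k -> j + k <= n.+1 -> a \in b_word k j -> a <= n.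
Proof.
move=> k0; elim: j => [|j IHj] jk.
  elim: k k0 jk => // k IHk _ jk; rewrite b_word0S mem_cat mem_rev mem_iota.
  case/orP => [ak|]; last by lia.
  by case: k IHk jk ak => // k IHk jk; apply: IHk => //; lia.
rewrite b_wordS // mem_cat mem_rev mem_iota => /orP[|]; last by lia.
by apply: IHj; lia.
Qed.

Lemma weight_rank_block n k j : j + k <= n.+1 ->
  weight_rank n (block k j) = \sum_(l < k) (j + l).+1.
Proof. by rewrite -ltnS => /(sum_interval (fun i => i)) <-. Qed.

Lemma runB_inord n f w : (forall a, a \in w -> a <= n) ->
  runB f [seq inord a : 'I_n.+1 | a <- w] = foldl actB f w.
Proof.
move=> wn; rewrite /runB -map_comp; congr foldl; rewrite -[RHS]map_id.
by apply/eq_in_map => a /wn an; rewrite /= inordK.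
Qed.

End BWords.

Section MainResult.
Variables (n : nat) (c : bool).
Implicit Types (k j : nat).

Local Notation XD := (minuscule_D n c).

(** Every reduced word for b_k^{0j} has the length of the given one and leads to
    the same block of ones, so it climbs at each letter, and by
    [alternate_climbs] so does its alternating version. *)
Lemma d_elt_climb k j : 0 < k -> j + k <= n.+1 -> exists u,
  [/\ climbs (base XD) u, run (base XD) u = interval_state k j
    & d_elt n c k j = cox_word (coxD n) u].
Proof.
move=> k0 jk; rewrite /d_elt /phi; set u := xget _ _.
have [ru ub] : reduced (coxB n) u /\ cox_word (coxB n) u = b_elt n k j.
  have [v rv vb] := reduced_word (b_elt n k j).
  pose R := [set u | reduced (coxB n) u /\ cox_word (coxB n) u = b_elt n k j]%classic.
  by apply: (@xgetPex _ [::] R); exists v.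
have run_u : runB (fun=> false) u = block k j.
  have /cox_wordP/runB_equiv -> := ub.
  by rewrite runB_inord ?run_b_word // => a; apply: b_word_bound.
have rk0 : weight_rank n (fun=> false) = 0 := rank_base XD.
have rk_u : weight_rank n (runB (fun=> false) u) = weight_rank n (fun=> false) + size u.
  apply/eqP; rewrite eqn_leq weight_rank_runB rk0 run_u weight_rank_block //.
  by rewrite -size_b_word // ru ub -(size_map (@inord n)) cox_length_word.
have [||cu agree] := alternate_climbs (c := c) (d := c) (F := base XD) _ _ rk_u.
- by rewrite eqxx.
- by [].
exists (alternate c u); split=> //.
apply: (@even_interval n) => // [|x x0]; first exact: even_state_run.
by rewrite agree // run_u.
Qed.

(** To extend the block by one, it is moved up by one, and a new one is created at
    position 1 and moved up to j + 1. *)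
Lemma interval_state_le k j : 0 < k -> j + k.+1 <= n.+1 ->
  state_le (X := XD) (interval_state k j) (interval_state k.+1 j).
Proof.
move=> k0 jk; have jk' : j + k <= n.+1 by lia.
pose w := rev (iota j.+1 k) ++ 0 :: iota 1 j.
have wn a : a \in w -> a <= n.
  by rewrite /w mem_cat mem_rev mem_iota inE mem_iota; lia.
pose u := [seq inord a : 'I_n.+1 | a <- w].
have run_w : runB (block k j) u = block k.+1 j.
  rewrite /u runB_inord // foldl_cat run_block_shift.
  rewrite -[LHS]/(foldl actB (flip1 (block k j.+1)) (iota 1 j)) flip1_block //.
  rewrite run_up //; apply/funext => x; rewrite /block /=; case: eqP => [->|nx]; first by lia.
  by case: ifP; lia.
have rk_u : weight_rank n (runB (block k j) u) = weight_rank n (block k j) + size u.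
  rewrite run_w !weight_rank_block // big_ord_recr /=; congr (_ + _).
  by rewrite size_map size_cat size_rev /= !size_iota; lia.
(* the first letter 0 has to get the sign that climbs from this state *)
pose d := (odd k != c).
have [||cu agree] := alternate_climbs (c := c) (d := d) (F := interval_state k j : XD) _ _ rk_u.
- by rewrite /interval_state /= /d; case: (odd k) c => [] [].
- by case=> [|x] //.
have [p [cp ep _]] := d_elt_climb k0 jk'.
exists (alternate d u) => //.
apply: (@even_interval n) => // [|x x0]; last by rewrite agree // run_w.
by rewrite -ep -run_cat; apply: even_state_run.
Qed.

Lemma interval_state_mono k k' j : 0 < k -> k <= k' -> j + k' <= n.+1 ->
  state_le (X := XD) (interval_state k j) (interval_state k' j).
Proof.
move=> k0; elim: k' => [|k' IHk']; first by lia.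
rewrite leq_eqVlt => /predU1P[-> _|kk' jk]; first exact: state_le_refl.
apply: state_le_trans (IHk' _ _) _; try lia.
by apply: interval_state_le; lia.
Qed.

Lemma d_elt_lt k k' j : 0 < k -> k < k' -> j + k' <= n.+1 ->
  (d_elt n c k j < d_elt n c k' j)%O.
Proof.
move=> k0 kk' jk.
have [|u [cu eu ->]] := d_elt_climb k0 (j := j); first by lia.
have [|u' [cu' eu' ->]] := d_elt_climb (k := k') _ jk; first by lia.
rewrite lt_neqAle; apply/andP; split; last first.
  apply: (climb_le cu cu'); rewrite eu eu'; apply: interval_state_mono => //.
  exact: ltnW.
apply: contraTneq kk' => /(congr1 (coset_state XD)).
rewrite !coset_state_word eu eu' => /(congr1 (@^~ (j + k'))).
rewrite /interval_state; case: eqP => [|_]; first by lia.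
by case: leqP => //; lia.
Qed.

(** The unique descent of the state of d_k^{0j}. *)
Definition last_letter k j (r : nodeD n) : bool :=
  match r with inl d => (j == 0) && (odd k == (d == c)) | inr i => j == i.+1 end.

(** A join-irreducible element with left descent [inl c] has no other left descent,
    so it climbs to a state all of whose descents are right descents, hence equal;
    these states are the blocks. Conversely a block has one descent only. *)
Lemma JI_D r w : JI (coxD n) (inl c) r w <->
  exists k j, [/\ 0 < k, j + k <= n.+1, last_letter k j r & w = d_elt n c k j].
Proof.
split=> [[jw lw rw]|[k [j [k0 jk last_r ->]]]].
  have [s sl] := join_irreducible_left_descent (@coxD_gen_inj n) jw.
  have [s' sr] := join_irreducible_right_descent (@coxD_gen_inj n) jw.
  have [|v cv vw] := ex_climb (X := XD) (w := w).
    by move=> x /sl-> /base_fix; rewrite (sl _ lw).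
  have down_r x : rank (act (run (base XD) v) x) < rank (run (base XD) v) -> x = r.
    move=> /(climb_right_descent cv); rewrite vw => /sr ->.
    by rewrite (sr _ rw).
  case/lastP: v cv vw down_r => [|v x] cv vw down_r.
    by move: rw; rewrite /right_descent -vw cox_word_nil cox_length1.
  have down_x : rank (act (run (base XD) (rcons v x)) x) < rank (run (base XD) (rcons v x)).
    by rewrite run_rcons actK; move: cv; rewrite climbs_rcons => -[].
  have xr := down_r _ down_x; rewrite xr in cv vw down_x down_r.
  have [k [j [k0 jk ef]]] := unique_down_interval (even_state_run _ _) down_x down_r.
  exists k, j; split=> //; first by move: down_x; rewrite ef [_ < _]interval_state_down.
  have [u [cu eu ->]] := d_elt_climb k0 jk; rewrite -vw.
  by apply: (climb_unique (X := XD)); rewrite ?ef.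
have [u [cu eu ->]] := d_elt_climb k0 jk.
have downE s : (rank (act (run (base XD) u) s) < rank (run (base XD) u)) = last_letter k j s.
  by rewrite eu [_ < _]interval_state_down.
split.
- apply: (climb_join_irreducible (r := r) cu); first by rewrite downE.
  move=> s; rewrite downE; case: s r last_r => [d|i] [d'|i'] /=.
  + by move=> /andP[_ /eqP->] /andP[_]; case: d d' c => [] [] [].
  + by move=> /eqP-> /andP[].
  + by move=> /andP[/eqP->].
  + by move=> /eqP-> /eqP[e]; congr inr; apply: val_inj.
- case: u cu eu downE => [|s u] cu eu _.
    by move: (congr1 (@^~ (j + k)) eu); rewrite /interval_state /=; case: eqP; lia.
  have es : s = inl c.
    apply: contrapT => /base_fix fix_s; move: cu.
    by rewrite climbs_cons fix_s ltnn => -[].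
  rewrite es in cu *; rewrite /left_descent cox_word_cons cox_genK -cox_word_cons.
  rewrite -(climb_reduced cu) ltnS; exact: cox_length_word.
- by apply: (climb_right_descent cu); rewrite downE.
Qed.

Lemma d_elt_chain (r : nodeD n) j (ks : seq nat) :
    sorted ltn ks -> (forall k, k \in ks <-> [/\ 0 < k, j + k <= n.+1 & last_letter k j r]) ->
    (forall k j', last_letter k j' r -> j' = j) ->
  is_chain (JI (coxD n) (inl c) r) [seq d_elt n c k j | k <- ks].
Proof.
move=> sks mem_ks uniq_j; split.
  apply/seteqP; split=> [w /JI_D[k [j' [k0 jk lr ->]]]|w /mapP[k /mem_ks[k0 jk lr] ->]].
    have ej := uniq_j _ _ lr; rewrite ej in jk lr *.
    by apply: map_f; apply/mem_ks.
  by apply/JI_D; exists k, j.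
apply: (homo_sorted_in (e := ltn)) sks => [k k'|]; last exact: allss.
by move=> /mem_ks[k0 _ _] /mem_ks[_ jk' _] kk'; apply: d_elt_lt.
Qed.

End MainResult.

(* [c = true] is the case of 0^+ and phi^+, [c = false] is the case obtained by
   interchanging 0^+ with 0^- (and phi^+ with phi^-). The node j = 1, ..., n is
   [inr i] with j = i + 1. *)
Theorem proposition5p31 (n : nat) (hn : (2 <= n)%N) :
  forall c : bool,
    [/\ is_chain (JI (coxD n) (inl c) (inl c))
          [seq d_elt n c k 0 | k <- iota 1 n.+1 & odd k],
        is_chain (JI (coxD n) (inl c) (inl (~~ c)))
          [seq d_elt n c k 0 | k <- iota 1 n.+1 & ~~ odd k]
      & forall i : 'I_n,
        is_chain (JI (coxD n) (inl c) (inr i))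
          [seq d_elt n c k i.+1 | k <- iota 1 (n.+1 - i.+1)]].
Proof.
move=> c; have sorted_iota l : sorted ltn (iota 1 l) by apply: iota_ltn_sorted.
split=> [||i].
- apply: d_elt_chain => [|k|k j' /andP[/eqP //]].
    exact: (sorted_filter ltn_trans).
  rewrite mem_filter mem_iota /= eqxx eqb_id; split=> [|[]]; last by lia.
  by move=> /andP[ok kn]; split=> //; lia.
- apply: d_elt_chain => [|k|k j' /andP[/eqP //]].
    exact: (sorted_filter ltn_trans).
  rewrite mem_filter mem_iota /=.
  have -> : (~~ c == c) = false by case: (c).
  rewrite eqbF_neg; split=> [|[]]; last by lia.
  by move=> /andP[ok kn]; split=> //; lia.
- apply: d_elt_chain => [//|k|k j' /eqP //].
  by rewrite mem_iota /= eqxx; have := ltn_ord i; split=> [|[]]; try split=> //; lia.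
Qed.
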